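(* Let $n\ge 3$ and let $G$ be a connected well-covered unicyclic graph of order $2n$. Then $\xi(C_n^{\ast})\le \xi(G)\le \xi(U_n^{\ast})$.
   Context: All graphs are finite, simple and undirected. A graph is well-covered if all of its maximal independent sets have the same size. A connected unicyclic graph is a connected graph containing exactly one cycle. The independence polynomial of a graph $G$ is $I(G,x)=\sum_{k\ge 0} i_kx^k$, where $i_k$ is the number of independent sets of size $k$ in $G$. It is known that the root of $I(G,x)$ of smallest modulus is real and lies in $[-1,0)$; it is denoted $\xi(G)$ (equivalently, the largest real root of $I(G,x)$). For a graph $G$, the graph star $G^{\ast}$ is obtained from $G$ by attaching, for each vertex $v$ of $G$, a new vertex $v^{\ast}$ joined by an edge to $v$ only. $C_n$ is the cycle on $n$ vertices. $U_n$ is the graph on $n$ vertices obtained from a triangle by attaching $n-3$ pendant vertices (leaves) to one fixed vertex of the triangle. *)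

(* Defs.v *)
From mathcomp Require Import all_boot all_order all_algebra all_field.

Set Implicit Arguments.
Unset Strict Implicit.
Unset Printing Implicit Defensive.

Import Order.TTheory GRing.Theory Num.Theory.

Record sgraph := SGraph {
  vertex :> finType;
  adj : rel vertex;
  adj_sym : symmetric adj;
  adj_irrefl : irreflexive adj
}.

Section GraphNotions.

Variable G : sgraph.

Definition independent (A : {set G}) : bool :=
  [forall x in A, forall y in A, ~~ adj x y].

Definition well_covered : Prop :=
  forall A B : {set G},
    maxset independent A -> maxset independent B -> #|A| = #|B|.

Definition connected_graph : Prop :=
  (0 < #|G|)%N /\ forall x y : G, connect (@adj G) x y.

(* A cycle is a subgraph, so it is identified with its edge set: the closed
   walks that differ by a rotation or a reflection give the same cycle. *)
Definition cycle_edges (c : seq G) : {set {set G}} :=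
  [set [set x; next c x] | x in c].

Definition is_cycle (E : {set {set G}}) : Prop :=
  exists c : seq G,
    [/\ (2 < size c)%N, ucycle (@adj G) c & E = cycle_edges c].

Definition unicyclic : Prop := exists! E : {set {set G}}, is_cycle E.

Definition num_indep (k : nat) : nat :=
  #|[set A : {set G} | independent A & #|A| == k]|.

Local Open Scope ring_scope.

(* The coefficients are integers, so that all complex roots lie in algC. *)
Definition indep_poly : {poly algC} :=
  \poly_(k < #|G|.+1) (num_indep k)%:R.

Definition indep_roots : seq algC :=
  sval (closed_field_poly_normal indep_poly).

(* A root of smallest modulus; the default 0 is never reached when G has a
   vertex (lemma xiP). *)
Definition xi : algC :=
  head 0 (sort (fun z w : algC => `|z| <= `|w|) indep_roots).

Lemma num_indep0 : num_indep 0 = 1%N.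
Proof.
have eq_set0 : [set A : {set G} | independent A & #|A| == 0%N] = [set set0].
  apply/setP=> A; rewrite !inE cards_eq0.
  case: eqP => [->|_]; last by rewrite andbF.
  by rewrite andbT; apply/forall_inP=> x; rewrite inE.
by rewrite /num_indep eq_set0 cards1.
Qed.

Lemma num_indep1 : num_indep 1 = #|G|.
Proof.
have eq_set1 : [set A : {set G} | independent A & #|A| == 1%N]
             = [set [set x] | x in [set: G]].
  apply/setP=> A; rewrite inE.
  apply/andP/imsetP=> [[_ /cards1P[x ->]]|[x _ ->]]; first by exists x.
  rewrite cards1; split=> //; apply/forall_inP=> y /set1P->.
  by apply/forall_inP=> z /set1P->; rewrite adj_irrefl.
by rewrite /num_indep eq_set1 card_imset ?cardsT //; apply: set1_inj.
Qed.

Lemma indep_poly_neq0 : indep_poly != 0.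
Proof.
apply/eqP=> /(congr1 (fun p : {poly algC} => p`_0)).
by rewrite coef_poly num_indep0 coef0; apply/eqP; rewrite oner_eq0.
Qed.

Lemma mem_indep_roots z : (z \in indep_roots) = root indep_poly z.
Proof.
rewrite /indep_roots; case: closed_field_poly_normal => r /= def_p.
rewrite def_p rootZ ?root_prod_XsubC //.
by rewrite lead_coef_eq0 indep_poly_neq0.
Qed.

Lemma has_indep_root : (0 < #|G|)%N -> exists z, root indep_poly z.
Proof.
move=> G_gt0; apply/closed_rootP/eqP=> /eqP size_p.
have: indep_poly`_1 = 0 by rewrite nth_default // (eqP size_p).
rewrite coef_poly ltnS G_gt0 num_indep1 => /eqP.
by rewrite pnatr_eq0 eqn0Ngt G_gt0.
Qed.

Lemma xiP : (0 < #|G|)%N ->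
  root indep_poly xi /\ forall z, root indep_poly z -> `|xi| <= `|z|.
Proof.
move=> /has_indep_root[z0]; rewrite -mem_indep_roots /xi => z0r.
set le_norm := (fun z w : algC => _).
have tot : total le_norm by move=> z w; apply: real_leVge; apply: normr_real.
have tr : transitive le_norm by move=> w z t; apply: le_trans.
have mem_s z : (z \in sort le_norm indep_roots) = root indep_poly z.
  by rewrite mem_sort mem_indep_roots.
have := sort_sorted tot indep_roots; move: mem_s.
case: (sort _ _) => [|x s] /= mem_s.
  by have := mem_s z0; rewrite -mem_indep_roots z0r.
rewrite (path_sortedE tr) => /andP[/allP x_le _]; split.
  by rewrite -mem_s mem_head.
by move=> z; rewrite -mem_s inE => /predU1P[->|/x_le].
Qed.

End GraphNotions.

Section GraphStar.

Variable G : sgraph.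

(* inl v is the vertex v of G and inr v is the leaf attached to v. *)
Definition star_adj : rel (G + G) := fun a b =>
  match a, b with
  | inl x, inl y => adj x y
  | inl x, inr y => x == y
  | inr x, inl y => x == y
  | inr _, inr _ => false
  end.

Fact star_adj_sym : symmetric star_adj.
Proof. by case=> x [] y //=; rewrite ?(eq_sym x) // adj_sym. Qed.

Fact star_adj_irrefl : irreflexive star_adj.
Proof. by case=> x //=; rewrite adj_irrefl. Qed.

Definition graph_star : sgraph := SGraph star_adj_sym star_adj_irrefl.

End GraphStar.

Section SpecialGraphs.

Variable n : nat.

(* i != j only matters for n = 1. *)
Definition Cn_adj : rel 'I_n := fun i j =>
  (i != j) && ((j == i.+1 %% n :> nat) || (i == j.+1 %% n :> nat)).

Fact Cn_adj_sym : symmetric Cn_adj.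
Proof. by move=> i j; rewrite /Cn_adj eq_sym orbC. Qed.

Fact Cn_adj_irrefl : irreflexive Cn_adj.
Proof. by move=> i; rewrite /Cn_adj eqxx. Qed.

Definition Cn : sgraph := SGraph Cn_adj_sym Cn_adj_irrefl.

(* The triangle is 0, 1, 2 and the vertices i >= 3 are leaves attached to 0. *)
Definition Un_adj : rel 'I_n := fun i j =>
  (i != j) &&
  [|| (i < 3) && (j < 3), i == 0 :> nat | j == 0 :> nat].

Fact Un_adj_sym : symmetric Un_adj.
Proof.
by move=> i j; rewrite /Un_adj eq_sym [(i < 3) && _]andbC [(i == 0 :> nat) || _]orbC.
Qed.

Fact Un_adj_irrefl : irreflexive Un_adj.
Proof. by move=> i; rewrite /Un_adj eqxx. Qed.

Definition Un : sgraph := SGraph Un_adj_sym Un_adj_irrefl.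

End SpecialGraphs.

(* Main.v *)
Require Import Defs.
From mathcomp Require Import all_boot all_order all_algebra all_field.
From mathcomp Require Import zify ring lra.

(* All the graphs that occur reduce to graph stars: an inner vertex of G (neither
   a leaf nor adjacent to one) which is adjacent to a support must lie on the
   cycle, which is then short, and as |G| is even the inner vertices are
   absent or form the edge x y of a 4-cycle s x y z; replacing the edge y z by
   x z preserves the independence polynomial and makes y a leaf of x.
   The independence polynomial of a graph star is
   (1 + X)^n I(H, X / (1 + X)), so it remains to compare the first positive
   zeros of I(H, -t) for connected unicyclic H of order n, among which U_n has
   the smallest and C_n the largest. Before the first zero all induced subgraphs
   have I(S, -t) > 0. Removing a non-cut vertex and using the monotonicity of
   I(S, -t) in S gives the bound by U_n. For C_n, one bounds the ratios
   I(W) / I(W - N) by the corresponding ratios for paths and for triangles with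
   a pendant path, the latter having the independence polynomials of cycles. *)

(** [xi] is picked by modulus among complex roots, so it has to be shown real: zeros off the
    negative axis are excluded up to and including the modulus of the first zero. Over [algR] the
    intermediate value theorem and the finiteness of the zero set are available. The bounds see the
    graph only through connectivity and the count [dedges = 2 * #|G|], which for a connected graph
    says that there is exactly one cycle. This count follows vertex deletions by arithmetic and is
    preserved by the edge switch, so the switched graph enters through these two properties alone.
    Two first zeros are compared by contradiction at the smaller one, where the other graph has only
    positive induced subgraphs, so that quotients make sense; they are written as products. For the
    bound by the cycle, the obstacle is that deleting a vertex disconnects the graph and may destroy
    its cycle. Hence the ratio statements concern a possibly disconnected [W] and a set [N] meeting
    each component, and a broken cycle is remembered as a component that meets [N] twice. *)

Set Implicit Arguments.
Unset Strict Implicit.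
Unset Printing Implicit Defensive.

Import Order.TTheory GRing.Theory Num.Theory.

Local Open Scope ring_scope.

(** * Independence polynomials of induced subgraphs *)

Section Neighbourhoods.

Variable G : sgraph.
Implicit Types (S T A B C D : {set G}) (v : G).

Definition nbh v : {set G} := [set y | adj v y].

Lemma in_nbh v y : (y \in nbh v) = adj v y.
Proof. by rewrite inE. Qed.

Lemma nbhC v y : (y \in nbh v) = (v \in nbh y).
Proof. by rewrite !inE adj_sym. Qed.

Lemma nbh_irr v : v \notin nbh v.
Proof. by rewrite inE adj_irrefl. Qed.

Lemma adj_neq (x y : G) : adj x y -> x != y.
Proof. by apply: contraTneq => ->; rewrite adj_irrefl. Qed.

Lemma indepP A :
  reflect (forall x y, x \in A -> y \in A -> ~~ adj x y) (independent A).
Proof.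
apply: (iffP forall_inP) => [h x y xA yA | h x xA].
  exact: (forall_inP (h x xA)).
by apply/forall_inP => y yA; apply: h.
Qed.

Lemma indep0 : independent (set0 : {set G}).
Proof. by apply/indepP => x y; rewrite inE. Qed.

Lemma indepS A B : A \subset B -> independent B -> independent A.
Proof.
move=> /subsetP sAB /indepP iB; apply/indepP => x y /sAB xB /sAB yB.
exact: iB.
Qed.

Lemma indepU1 v A : v \notin A ->
  independent (v |: A) = independent A && [disjoint A & nbh v].
Proof.
move=> vA; apply/idP/andP => [iA | [/indepP iA dA]].
  split; first by apply: indepS iA; apply: subsetUr.
  apply/pred0P => y /=; apply/negP => /andP[yA].
  rewrite inE; apply/negP; move/indepP: iA; apply; first exact: setU11.
  by rewrite setU1r.
have nv y : y \in A -> ~~ adj v y.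
  by move=> yA; move: (disjointFr dA yA); rewrite inE => ->.
apply/indepP => x y /setU1P[->|xA] /setU1P[->|yA]; rewrite ?adj_irrefl //.
- exact: nv.
- by rewrite adj_sym; exact: nv.
- exact: iA.
Qed.

Lemma disjoint_nbhD1 S v :
  [disjoint S & nbh v] = ((S :\ v) :\: nbh v == S :\ v).
Proof.
apply/idP/eqP => [d | /setDidPl d].
  by apply/setDidPl; apply: disjointWl d; apply: subsetDl.
rewrite disjoints_subset; apply/subsetP => y yS; rewrite inE.
have [->|ne] := eqVneq y v; first exact: nbh_irr.
by rewrite (disjointFr d) // !inE ne.
Qed.

End Neighbourhoods.

Section IndependencePolynomial.

Variable G : sgraph.
Implicit Types (S T A B C D : {set G}) (v : G).

(** Induced subgraphs are vertex sets of a fixed graph, so recursion never changes the type. The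
    point ranges over any commutative ring: it is instantiated by ['X], by complex and by real
    algebraic numbers. *)
Definition ipoly (R : comPzRingType) S (x : R) : R :=
  \sum_(A : {set G} | (A \subset S) && independent A) x ^+ #|A|.

Section Ring.

Variables (R : comPzRingType) (x : R).

Lemma ipoly0 : ipoly set0 x = 1.
Proof.
rewrite /ipoly (bigD1 set0) /= ?sub0set ?indep0 // cards0 expr0 big1 ?addr0 //.
by move=> A /andP[/andP[/[!subset0]->]].
Qed.

Lemma ipolyx0 S : ipoly S 0 = 1 :> R.
Proof.
rewrite /ipoly (bigD1 set0) /= ?sub0set ?indep0 // cards0 expr0 big1 ?addr0 //.
by move=> A /andP[_]; rewrite -cards_eq0 -lt0n => /prednK <-; rewrite expr0n.
Qed.

(** Independent sets are split by whether they contain [v]; removing [v] from those that do leaves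
    the independent sets avoiding its closed neighbourhood. *)
Lemma ipoly_rec S v : v \in S ->
  ipoly S x = ipoly (S :\ v) x + x * ipoly ((S :\ v) :\: nbh v) x.
Proof.
move=> vS; rewrite /ipoly (bigID (fun A : {set G} => v \in A)) /= addrC; congr (_ + _).
  apply: eq_bigl => A; rewrite subsetD1.
  by case: (A \subset S); case: (v \in A); case: (independent A).
rewrite mulr_sumr (reindex_onto (fun A => v |: A) (fun A => A :\ v)) /=; last first.
  by move=> A /andP[_ vA]; rewrite setD1K.
apply: eq_big => [A | A /andP[_ /eqP eA]]; last first.
  have vA : v \notin A by rewrite -eA setD11.
  by rewrite cardsU1 vA /= exprS.
rewrite setU11 andbT; have [vA | vA] := boolP (v \in A).
  rewrite (subsetD _ (S :\ v)) subsetD1 vA /= !andbF /=.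
  by apply/negP => /andP[_ /eqP eA]; move: vA; rewrite -eA setD11.
rewrite setU1K // eqxx andbT indepU1 // subUset sub1set vS /=.
by rewrite (subsetD _ (S :\ v)) subsetD1 vA andbT -andbA; congr (_ && _); rewrite andbC.
Qed.

Lemma ipoly_isolated S v : v \in S -> [disjoint S & nbh v] ->
  ipoly S x = (1 + x) * ipoly (S :\ v) x.
Proof.
move=> vS dS; rewrite (ipoly_rec vS) mulrDl mul1r; congr (_ + _ * ipoly _ _).
by apply/setDidPl; apply: disjointWl dS; apply: subsetDl.
Qed.

End Ring.

Lemma ipoly_edgeless (R : comPzRingType) (x : R) S : independent S ->
  ipoly S x = (1 + x) ^+ #|S|.
Proof.
have [n] := ubnP #|S|; elim: n S => // n IH S leS iS.
have [-> | /set0Pn[v vS]] := eqVneq S set0; first by rewrite cards0 ipoly0.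
have cS := cardsD1 v S; rewrite vS in cS.
have iS' : independent (S :\ v) by apply: indepS iS; apply: subsetDl.
have : independent (v |: (S :\ v)) by rewrite setD1K.
rewrite indepU1 ?setD11 // => /andP[_ dS].
rewrite (ipoly_rec _ vS) (setDidPl dS) IH //; last by lia.
by rewrite cS exprS mulrDl mul1r.
Qed.

Lemma ipolyU (R : comPzRingType) (x : R) C D :
    [disjoint C & D] -> (forall a b, a \in C -> b \in D -> ~~ adj a b) ->
  ipoly (C :|: D) x = ipoly C x * ipoly D x.
Proof.
have [n] := ubnP #|C|; elim: n C => // n IH C leC dCD nCD.
have [-> | /set0Pn[v vC]] := eqVneq C set0; first by rewrite set0U ipoly0 mul1r.
have cC := cardsD1 v C; rewrite vC in cC.
have vD : v \notin D by rewrite (disjointFr dCD vC).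
have DvD : D :\ v = D by apply/setDidPl; rewrite disjoint_sym disjoints1.
have IHs C' : C' \subset C :\ v -> ipoly (C' :|: D) x = ipoly C' x * ipoly D x.
  move=> sC'; have sC : C' \subset C by apply: subset_trans sC' (subsetDl _ _).
  apply: IH.
  - by have := subset_leq_card sC'; lia.
  - exact: disjointWl dCD.
  - by move=> a b /(subsetP sC); apply: nCD.
have vU : v \in C :|: D by rewrite inE vC.
rewrite (ipoly_rec _ vU) (ipoly_rec _ vC) mulrDl -mulrA; congr (_ + _ * _).
  by rewrite -IHs // setDUl DvD.
rewrite -IHs ?subsetDl //; congr ipoly.
rewrite !setDUl DvD; congr (_ :|: _).
apply/setP => b; rewrite !inE; have [bD|] := boolP (b \in D); rewrite ?andbF //=.
by rewrite (nCD v b) //= andbT; apply: contraNneq vD => <-.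
Qed.

Lemma rmorph_ipoly (R R' : comPzRingType) (f : {rmorphism R -> R'}) S x :
  f (ipoly S x) = ipoly S (f x).
Proof. by rewrite rmorph_sum; apply: eq_bigr => A _; rewrite rmorphXn. Qed.

Lemma horner_ipoly (R : comNzRingType) S (p : {poly R}) x :
  (ipoly S p).[x] = ipoly S p.[x].
Proof. exact: (rmorph_ipoly (horner_eval x)). Qed.

Lemma indep_polyE : indep_poly G = ipoly setT 'X.
Proof.
rewrite /indep_poly poly_def /ipoly.
rewrite (partition_big (fun A : {set G} => inord #|A| : 'I_#|G|.+1) predT) //=.
apply: eq_bigr => k _; rewrite (eq_bigr (fun=> 'X^k)) => [|A /andP[_ /eqP <-]].
  rewrite sumr_const scaler_nat; congr (_ *+ _).
  apply: eq_card => A; rewrite [in LHS]inE unfold_in /= subsetT /=; congr (_ && _).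
  rewrite -val_eqE /= inordK // ltnS; exact: max_card.
by rewrite inordK // ltnS; exact: max_card.
Qed.

Lemma root_indep_poly z : root (indep_poly G) z = (ipoly setT z == 0).
Proof. by rewrite rootE indep_polyE horner_ipoly hornerX. Qed.

End IndependencePolynomial.

(** * The first zero *)

Section Connectivity.

Variable G : sgraph.
Implicit Types (S C : {set G}).

Definition closed_in S C : Prop :=
  forall x y, x \in C -> y \in S -> adj x y -> y \in C.

(** Connectivity of an induced subgraph without paths: the only nonempty closed subset is the
    whole. *)
Definition conn S : Prop :=
  S != set0 /\
  forall C, C \subset S -> C != set0 -> closed_in S C -> C = S.

End Connectivity.

Section FirstRoot.

Variable G : sgraph.
Implicit Types (S T A B C D : {set G}) (v : G).

(** Equality in the reverse triangle inequality forces 1 and [- z] to have the same direction, that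
    is, [z] to be real and nonpositive. *)
Lemma normDl_lt (z : algC) : z != - `|z| -> 1 - `|z| < `|1 + z|.
Proof.
move=> zN; rewrite lt_neqAle; apply/andP; split; last first.
  by have := lerB_dist 1 (- z); rewrite normr1 normrN opprK.
apply: contra zN => /eqP e.
have := @normCBeq algC 1 (- z).
rewrite opprK normr1 normrN => /(_ (esym e)) [u nu [e1 e2]].
by move: e2; rewrite -[u]mul1r -e1 mulr1 => <-; rewrite opprK.
Qed.

Section Modulus.

Variable z : algC.
Hypothesis z_neq0 : z != 0.
Hypothesis zN : z != - `|z|.

(* The quotient |I(S, z)| / I(S, -|z|) increases strictly with S; the products
   below clear the denominators. *)
Lemma ipoly_norm_lt S T :
    (forall A, A \subset S -> 0 < ipoly A (- `|z|)) -> T \proper S ->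
  `|ipoly T z| * ipoly S (- `|z|) < `|ipoly S z| * ipoly T (- `|z|).
Proof.
have [n] := ubnP #|S|; elim: n S T => // n IH S T leS Spos.
have zgt0 : 0 < `|z| by rewrite normr_gt0.
have step v : v \in S ->
    `|ipoly (S :\ v) z| * ipoly S (- `|z|)
      < `|ipoly S z| * ipoly (S :\ v) (- `|z|).
  move=> vS; have cS := cardsD1 v S; rewrite vS in cS.
  have Spos' A : A \subset S :\ v -> 0 < ipoly A (- `|z|).
    by move=> sA; apply/Spos/(subset_trans sA)/subsetDl.
  have [dS | ndS] := boolP [disjoint S & nbh v].
    rewrite !(ipoly_isolated _ vS dS) normrM mulrCA -[ltRHS]mulrA.
    rewrite ltr_pM2r ?normDl_lt // mulr_gt0 ?Spos' //.
    have [->|nS1] := eqVneq (S :\ v) set0; first by rewrite ipoly0 normr1.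
    have := IH (S :\ v) set0 _ Spos'; rewrite proper0 !ipoly0 normr1 mul1r mulr1.
    move=> /(_ _ nS1) h; apply: lt_trans (h _); first exact: Spos'.
    by lia.
  set S1 := S :\ v; set S2 := S1 :\: nbh v.
  have lt12 : `|ipoly S2 z| * ipoly S1 (- `|z|)
               < `|ipoly S1 z| * ipoly S2 (- `|z|).
    apply: IH => //; first by rewrite /S1; lia.
    rewrite properEneq subsetDl andbT; by rewrite -disjoint_nbhD1.
  rewrite !(ipoly_rec _ vS) -/S1 -/S2.
  have tri : `|ipoly S1 z| - `|z| * `|ipoly S2 z| <= `|ipoly S1 z + z * ipoly S2 z|.
    have := lerB_dist (ipoly S1 z) (- (z * ipoly S2 z)).
    by rewrite opprK normrN normrM.
  have p1 : 0 < ipoly S1 (- `|z|) by exact: Spos'.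
  apply: lt_le_trans (ler_wpM2r (ltW p1) tri).
  rewrite mulrDr mulrBl ltrD2l mulNr mulrN ltrN2 mulrCA -mulrA.
  by rewrite ltr_pM2l.
move=> /properP[sTS [v vS vT]].
have sTv : T \subset S :\ v by rewrite subsetD1 sTS.
have [->|neT] := eqVneq T (S :\ v); first exact: step.
have cS := cardsD1 v S; rewrite vS in cS.
have Spos' A : A \subset S :\ v -> 0 < ipoly A (- `|z|).
  by move=> sA; apply/Spos/(subset_trans sA)/subsetDl.
have lt1 := IH (S :\ v) T _ Spos' _.
have {}lt1 : `|ipoly T z| * ipoly (S :\ v) (- `|z|) <
   `|ipoly (S :\ v) z| * ipoly T (- `|z|).
  by apply: lt1; [lia | rewrite properEneq neT].
have lt2 := step v vS.
have p0 : 0 < ipoly S (- `|z|) by apply: Spos.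
have p1 : 0 < ipoly (S :\ v) (- `|z|) by apply: Spos'.
have p2 : 0 < ipoly T (- `|z|) by apply: Spos.
rewrite -(ltr_pM2r p1) mulrAC.
apply: (@lt_trans _ _ (`|ipoly (S :\ v) z| * ipoly T (- `|z|) * ipoly S (- `|z|))).
  by rewrite ltr_pM2r.
by rewrite mulrAC [ltRHS]mulrAC ltr_pM2r.
Qed.

(** A zero would give |I(S1, z)| = |z| |I(S2, z)|, whereas the strict comparison makes |I(S1, z)| /
    |I(S2, z)| larger than I(S1, -|z|) / I(S2, -|z|), which is at least |z|. Strict positivity is
    asked of proper subsets only, so the lemma still applies at the first zero itself. *)
Lemma ipoly_neq0 S :
    (forall A, A \proper S -> 0 < ipoly A (- `|z|)) ->
    0 <= ipoly S (- `|z|) ->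
  ipoly S z != 0.
Proof.
move=> Spos S0.
have zgt0 : 0 < `|z| by rewrite normr_gt0.
have nz A : A \proper S -> ipoly A z != 0.
  move=> pA; have [->|nA] := eqVneq A set0; first by rewrite ipoly0 oner_eq0.
  have Apos B : B \subset A -> 0 < ipoly B (- `|z|).
    by move=> sB; apply/Spos/(sub_proper_trans sB).
  have := @ipoly_norm_lt A set0 Apos.
  rewrite proper0 nA !ipoly0 normr1 mul1r mulr1 => /(_ isT) h.
  by rewrite -normr_gt0; apply: lt_trans h; apply: Apos.
have [->|/set0Pn[v vS]] := eqVneq S set0; first by rewrite ipoly0 oner_eq0.
have pS1 : S :\ v \proper S by rewrite properD1.
have [dS | ndS] := boolP [disjoint S & nbh v].
  rewrite (ipoly_isolated _ vS dS) mulf_neq0 ?nz //.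
  move: S0; rewrite (ipoly_isolated _ vS dS) pmulr_lge0 ?Spos // => le0.
  by rewrite -normr_gt0; apply: le_lt_trans le0 (normDl_lt zN).
move: S0; rewrite !(ipoly_rec _ vS).
set S1 := S :\ v; set S2 := S1 :\: nbh v => S0.
have lt12 : `|ipoly S2 z| * ipoly S1 (- `|z|)
             < `|ipoly S1 z| * ipoly S2 (- `|z|).
  apply: ipoly_norm_lt => [A sA|]; first by apply/Spos/(sub_proper_trans sA).
  rewrite properEneq subsetDl andbT; by rewrite -disjoint_nbhD1.
apply/eqP => e0; have e1 : `|ipoly S1 z| = `|z| * `|ipoly S2 z|.
  by move/eqP: e0; rewrite addr_eq0 => /eqP ->; rewrite normrN normrM.
move: lt12; rewrite e1 -mulrA mulrCA ltr_pM2l; last first.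
  rewrite normr_gt0; apply: nz; apply: sub_proper_trans pS1; exact: subsetDl.
move=> lt1; move: S0; rewrite mulNr subr_ge0 => /(lt_le_trans lt1).
by rewrite ltxx.
Qed.

End Modulus.

(** The roots are listed by splitting the polynomial over [algC]; those that are real and positive
    form a finite nonempty list, which has a minimum. *)
Lemma min_pos_root (p : {poly algR}) r : p != 0 -> 0 < r -> root p r ->
  exists t, [/\ 0 < t, root p t & forall s, 0 < s -> root p s -> t <= s].
Proof.
move=> p0 r0 pr; have [rs ep] := closed_field_poly_normal (map_poly algRval p).
have memrs s : root p s = (algRval s \in rs).
  rewrite -(fmorph_root algRval) ep rootZ ?root_prod_XsubC //.
  by rewrite lead_coef_eq0 map_poly_eq0.
pose ts := [seq s <- pmap insub rs | 0 < (s : algR)].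
have memts s : (s \in ts) = (0 < s) && root p s.
  rewrite mem_filter memrs; congr (_ && _).
  by rewrite mem_pmap_sub.
have nts : ts != [::] by apply: contraTneq pr => e; have := memts r; rewrite e r0 /= => <-.
have [t tts tmin] : exists2 t, t \in ts & {in ts, forall s, t <= s}.
  elim: (ts) nts => // a [|b l] IH _.
    by exists a; rewrite ?mem_head // => s; rewrite inE => /eqP->.
  have [//|t tl tmin] := IH.
  have [le|lt] := leP a t.
    exists a; rewrite ?mem_head // => s; rewrite inE => /predU1P[-> //|/tmin].
    exact: le_trans.
  exists t; first by rewrite inE tl orbT.
  by move=> s; rewrite inE => /predU1P[->|/tmin//]; apply: ltW.
move: tts; rewrite memts => /andP[t0 pt]; exists t; split => // s s0 ps.
by apply: tmin; rewrite memts s0.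
Qed.

(** The value at 0 is 1, so a negative value at [b] would create a zero in between. *)
Lemma ipoly_ge0_of_noroot (S : {set G}) (b : algR) : 0 <= b ->
    (forall s, 0 < s < b -> ipoly S (- s) != 0) -> 0 <= ipoly S (- b).
Proof.
move=> b0 nr; rewrite leNgt; apply/negP => lt0.
have ev (s : algR) : (- ipoly S (- 'X)).[s] = - ipoly S (- s).
  by rewrite hornerN horner_ipoly hornerN hornerX.
have [|s /andP[s0 sb]] := @poly_ivt algR (- ipoly S (- 'X)) 0 b b0.
  by rewrite !ev !oppr0 ipolyx0 oppr_le0 ler01 oppr_ge0 ltW.
rewrite rootE ev oppr_eq0 => e.
suff sb' : 0 < s < b by move: (nr s sb'); rewrite e.
rewrite !lt_neqAle s0 sb !andbT; apply/andP; split.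
  by apply: contraTneq e => <-; rewrite oppr0 ipolyx0 oner_eq0.
by apply: contraTneq e => ->; rewrite ltr0_neq0.
Qed.

(* An inclusion-minimal S with I(S, -t) = 0 must be the whole graph: otherwise
   adding to S an adjacent vertex would make I(S, -t) negative. *)
Lemma first_root : conn [set: G] ->
  exists t : algR,
    [/\ 0 < t, ipoly [set: G] (- t) = 0,
        forall S, S != setT -> 0 < ipoly S (- t),
        forall s S, 0 <= s < t -> 0 < ipoly S (- s)
      & xi G = - algRval t].
Proof.
move=> [nT cT].
have Ggt0 : (0 < #|G|)%N by rewrite -cardsT card_gt0.
(* The least positive root of this product is the first zero over all induced subgraphs at once. *)
pose q : {poly algR} := \prod_(S : {set G}) ipoly S (- 'X).
have rq s : reflect (exists S : {set G}, ipoly S (- s) = 0) (root q s).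
  rewrite rootE horner_prod; apply: (iffP (prodf_eq0 _ _)).
    by case=> S _ /eqP; rewrite horner_ipoly hornerN hornerX; exists S.
  by case=> S e; exists S => //; rewrite horner_ipoly hornerN hornerX e.
have q0 : q != 0.
  apply/eqP => e; have /rq[S] : root q 0 by rewrite e root0.
  by rewrite oppr0 ipolyx0 => /eqP; rewrite oner_eq0.
have rt (S : {set G}) (s : algR) : ipoly S (- algRval s) = algRval (ipoly S (- s)).
  by rewrite rmorph_ipoly rmorphN.
have rt0 (S : {set G}) (s : algR) : 0 < ipoly S (- s) -> 0 < ipoly S (- algRval s).
  by rewrite rt.
have [z0 rz0] := has_indep_root Ggt0.
have z_neq0 z : root (indep_poly G) z -> z != 0.
  by apply: contraTneq => ->; rewrite root_indep_poly ipolyx0 oner_eq0.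
(* The modulus of any complex root bounds a positive zero: otherwise every I(S, -|z0|) is positive,
   and [ipoly_neq0] says that [z0] is no root. *)
have [r [r_gt0 rootr]] : exists r, 0 < r /\ root q r.
  pose r := in_algR (normr_real z0).
  have r0 : 0 < r by change (0 < `|z0|); rewrite normr_gt0 z_neq0.
  have [e|ne] := eqVneq z0 (- `|z0|).
    exists r; split => //; apply/rq; exists setT; apply/val_inj.
    rewrite -[val _]rt /= -e; apply/eqP.
    by rewrite -root_indep_poly.
  have [|np] := boolP [exists S : {set G}, ipoly S (- r) <= 0].
    case/existsP => S; rewrite le_eqVlt => /predU1P[e|lt0].
      by exists r; split => //; apply/rq; exists S.
    have ev (s : algR) : (- ipoly S (- 'X)).[s] = - ipoly S (- s).
      by rewrite hornerN horner_ipoly hornerN hornerX.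
    have [|s /andP[s0 sb]] := @poly_ivt algR (- ipoly S (- 'X)) 0 r (ltW r0).
      by rewrite !ev !oppr0 ipolyx0 oppr_le0 ler01 oppr_ge0 ltW.
    rewrite rootE ev oppr_eq0 => /eqP e.
    exists s; split; last by apply/rq; exists S.
    rewrite lt_neqAle s0 andbT eq_sym; apply: contra_eq_neq e => ->.
    by rewrite oppr0 ipolyx0 oner_eq0.
  have pos (S : {set G}) : 0 < ipoly S (- `|z0|).
    apply: (rt0 S r); rewrite ltNge; apply: contra np => h.
    by apply/existsP; exists S.
  have := @ipoly_neq0 z0 (z_neq0 _ rz0) ne setT (fun A _ => pos A) (ltW (pos _)).
  by rewrite -root_indep_poly rz0.
have [t [t0 rtt tmin]] := min_pos_root q0 r_gt0 rootr.
have nr (S : {set G}) s : 0 < s < t -> ipoly S (- s) != 0.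
  move=> /andP[s0 st]; apply: contraL st => /eqP e; rewrite -leNgt.
  by apply: tmin => //; apply/rq; exists S.
have t_ge (S : {set G}) : 0 <= ipoly S (- t).
  by apply: ipoly_ge0_of_noroot (ltW t0) (nr S).
have s_gt s (S : {set G}) : 0 <= s < t -> 0 < ipoly S (- s).
  move=> /andP[]; rewrite le_eqVlt => /predU1P[<- _|s0 st].
    by rewrite oppr0 ipolyx0.
  rewrite lt_neqAle eq_sym nr ?s0 //= ipoly_ge0_of_noroot ?ltW // => s' /andP[s'0 s's].
  by rewrite nr // s'0 (lt_trans s's).
have proper0 (S : {set G}) : ipoly S (- t) = 0 -> S = setT.
  have [n] := ubnP #|S|; elim: n S => // n IH S leS e.
  have [//|nS] := eqVneq S setT.
  have [eS|nS0] := eqVneq S set0.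
    by move/eqP: e; rewrite eS ipoly0 oner_eq0.
  have [b] : exists b, [exists a in S, adj a b && (b \notin S)].
    have [/existsP//|/existsPn h] := boolP [exists b, [exists a in S, adj a b && (b \notin S)]].
    case/eqP: nS; apply: cT => //.
    move=> x y xS _ xy; have /exists_inPn/(_ x xS) := h y.
    by rewrite xy negbK.
  case/exists_inP => a aS /andP[ab bS].
  have := t_ge (b |: S); rewrite (ipoly_rec _ (setU11 b S)) setU1K // e add0r mulNr.
  rewrite oppr_ge0 pmulr_rle0 // => le0.
  have /IH h : (#|S :\: nbh b| < n)%N.
    rewrite ltnS in leS; apply: leq_trans leS; apply: proper_card.
    rewrite properEneq subsetDl andbT.
    by apply: contraTneq aS => <-; rewrite !inE adj_sym ab.
  have /setP/(_ a) : S :\: nbh b = setT by apply/h/eqP; rewrite eq_le le0 t_ge.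
  by rewrite !inE adj_sym ab.
have IT : ipoly [set: G] (- t) = 0.
  by have /rq[S e] := rtt; rewrite -(proper0 S e).
have p_gt (S : {set G}) : S != setT -> 0 < ipoly S (- t).
  move=> nS; rewrite lt_neqAle t_ge andbT eq_sym; apply: contra nS => /eqP e.
  by rewrite (proper0 S e).
exists t; split => //.
have [rx xmin] := xiP Ggt0.
have le_t : `|xi G| <= algRval t.
  have t_ge0 : 0 <= algRval t by exact: (ltW t0).
  have := xmin (- algRval t); rewrite root_indep_poly rt IT eqxx normrN.
  by rewrite (ger0_norm t_ge0); apply.
pose r1 := in_algR (normr_real (xi G)).
have r10 : 0 < r1 by change (0 < `|xi G|); rewrite normr_gt0 z_neq0.
have [e|ne] := eqVneq (xi G) (- `|xi G|).
  have e0 : ipoly [set: G] (- r1) = 0.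
    by apply/val_inj; rewrite -[val _]rt /= -e; apply/eqP; rewrite -root_indep_poly.
  rewrite e; congr (- _); apply/eqP; rewrite eq_le le_t /=.
  have : t <= r1 by apply: tmin => //; apply/rq; exists setT.
  by [].
(* A root of modulus at most [t] off the negative axis is impossible, whether its modulus equals [t]
   or is smaller. *)
have := @ipoly_neq0 (xi G) (z_neq0 _ rx) ne setT.
rewrite -root_indep_poly rx => h; suff: ~~ true by []; apply: h.
  move=> A; rewrite properT => nA; apply: (rt0 A r1).
  have : r1 <= t by exact: le_t.
  rewrite le_eqVlt => /predU1P[->|lt]; first exact: p_gt.
  by apply: s_gt; rewrite (ltW r10).
have ge0 : 0 <= ipoly [set: G] (- r1).
  have : r1 <= t by exact: le_t.
  rewrite le_eqVlt => /predU1P[->|lt]; first by rewrite IT.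
  by apply: (ltW (s_gt r1 _ _)); rewrite (ltW r10).
change (0 <= ipoly [set: G] (- algRval r1)); rewrite rt.
exact: ge0.
Qed.

End FirstRoot.

(** * Lower bound by U_n *)

Section EdgeCount.

Variable G : sgraph.
Implicit Types (S T A B C D : {set G}) (v : G).

(* Twice the number of edges of the subgraph induced by S. *)
Definition dedges S : nat := \sum_(v in S) #|nbh v :&: S|.

Lemma card_nbhI_sum v S : #|nbh v :&: S| = (\sum_(u in S) adj u v)%N.
Proof.
rewrite -sum1_card big_mkcond [RHS]big_mkcond /=; apply: eq_bigr => u _.
by rewrite !inE adj_sym andbC; case: (u \in S); case: (adj u v).
Qed.

Lemma dedges_rec S v : v \in S ->
  dedges S = (dedges (S :\ v) + 2 * #|nbh v :&: S|)%N.
Proof.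
move=> vS; rewrite /dedges (big_setD1 v) //=.
have -> : (\sum_(u in S :\ v) #|nbh u :&: S|
           = \sum_(u in S :\ v) (#|nbh u :&: (S :\ v)| + adj u v))%N.
  apply: eq_bigr => u _; rewrite (cardsD1 v (nbh u :&: S)) !inE vS andbT addnC.
  by congr (_ + _)%N; apply: eq_card => w; rewrite !inE; case: eqP; rewrite ?andbF.
rewrite big_split /= addnCA mul2n -addnn; congr (_ + (_ + _))%N.
by rewrite [in RHS]card_nbhI_sum [RHS](big_setD1 v) //= adj_irrefl add0n.
Qed.

Lemma dedges0 : dedges set0 = 0%N.
Proof. by rewrite /dedges big_set0. Qed.

(** Parity lets strict inequalities between edge counts and even numbers be improved by 2. *)
Lemma odd_dedges S : ~~ odd (dedges S).
Proof.
have [n] := ubnP #|S|; elim: n S => // n IH S leS.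
have [->|/set0Pn[v vS]] := eqVneq S set0; first by rewrite dedges0.
have cS := cardsD1 v S; rewrite vS in cS.
rewrite (dedges_rec vS) oddD oddM /= addbF; apply: IH; lia.
Qed.

(** Its use: a nonempty set spanning at least as many edges as it has vertices has three or more
    vertices. *)
Lemma dedges_leq S : (dedges S <= #|S| * #|S|.-1)%N.
Proof.
rewrite /dedges -sum_nat_const; apply: leq_sum => v vS.
rewrite (cardsD1 v S) vS /=; apply: subset_leq_card; apply/subsetP => w.
by rewrite !inE => /andP[/adj_neq]; rewrite eq_sym => -> ->.
Qed.

Lemma conn_adj_out S T : conn S -> T \subset S -> T != set0 -> T != S ->
  exists x y, [/\ x \in T, y \in S, y \notin T & adj x y].
Proof.
move=> [_ cS] sTS T0 TS.
have [/exists_inP[x xT /exists_inP[y yS /andP[yT xy]]]|] :=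
    boolP [exists x in T, exists y in S, (y \notin T) && adj x y].
  by exists x, y.
move=> /exists_inPn h; case/eqP: TS; apply: cS => // x y xT yS xy.
by have /exists_inPn/(_ y yS) := h x xT; rewrite xy andbT negbK.
Qed.

Lemma connU1 T x y : conn T -> x \in T -> adj x y -> conn (y |: T).
Proof.
move=> [T0 cT] xT xy; split; first by apply/set0Pn; exists y; rewrite setU11.
move=> C sC C0 clC; have [yT|yT] := boolP (y \in T).
  have e : y |: T = T by apply/setUidPr; rewrite sub1set.
  by move: sC clC; rewrite e => sC clC; apply: cT.
have [e|CT0] := eqVneq (C :&: T) set0.
  have [z zC] := set0Pn _ C0.
  have := subsetP sC z zC; rewrite !inE => /predU1P[ez|zT].
    have : x \in C :&: T.
      rewrite inE xT andbT; apply: (clC z) => //; first by rewrite !inE xT orbT.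
      by rewrite ez adj_sym.
    by rewrite e inE.
  have : z \in C :&: T by rewrite inE zC.
  by rewrite e inE.
have eT : C :&: T = T.
  apply: cT => //; first exact: subsetIr.
  move=> a b; rewrite !inE => /andP[aC aT] bT ab; rewrite bT andbT.
  by apply: (clC a) => //; rewrite !inE bT orbT.
have sTC : T \subset C by rewrite -eT subsetIl.
have yC : y \in C.
  by apply: (clC x) => //; [exact: (subsetP sTC) | rewrite setU11].
by apply/eqP; rewrite eqEsubset sC subUset sub1set yC.
Qed.

Lemma conn1 v : conn [set v].
Proof.
split; first by apply/set0Pn; exists v; rewrite set11.
by move=> C sC C0 _; apply/eqP; rewrite eqEcard sC cards1 card_gt0.
Qed.

(** A connected subset can be grown one adjacent vertex at a time; at size [#|S|.-1] the missing
    vertex is the one sought. *)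
Lemma conn_noncut S : conn S -> (1 < #|S|)%N ->
  exists v, [/\ v \in S, conn (S :\ v) & (0 < #|nbh v :&: S|)%N].
Proof.
move=> cS lt1.
have grow k : (0 < k <= #|S|)%N -> exists T, [/\ T \subset S, #|T| = k & conn T].
  elim: k => // k IH /andP[_ lek].
  have [->|k0] := posnP k.
    have [v vS] := set0Pn _ cS.1; exists [set v]; split; rewrite ?sub1set ?cards1 //.
    exact: conn1.
  have [|T [sT cardT cT]] := IH; first by rewrite k0 ltnW.
  have [||x [y [xT yS yT xy]]] := conn_adj_out cS sT.
  - by rewrite -card_gt0 cardT.
  - by apply: contraTneq lek => <-; rewrite cardT ltnn.
  exists (y |: T); split; first by rewrite subUset sub1set yS.
    by rewrite cardsU1 yT cardT.
  exact: connU1 xT xy.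
have [|T [sT cardT cT]] := grow #|S|.-1; first by lia.
have nTS : T != S by apply: contraTneq lt1 => e; move: cardT; rewrite e; lia.
have [|x [y [xT yS yT xy]]] := conn_adj_out cS sT _ nTS; first exact: cT.1.
have eT : T = S :\ y.
  apply/eqP; rewrite eqEcard subsetD1 sT yT /= cardT (cardsD1 y S) yS; lia.
exists y; split => //; first by rewrite -eT.
by rewrite card_gt0; apply/set0Pn; exists x; rewrite !inE adj_sym xy (subsetP sT).
Qed.

Lemma conn_dedges S : conn S -> (2 * #|S| <= dedges S + 2)%N.
Proof.
have [n] := ubnP #|S|; elim: n S => // n IH S leS cS.
have [le1|gt1] := leqP #|S| 1; first by lia.
have [v [vS cSv dv]] := conn_noncut cS gt1.
have cardS := cardsD1 v S; rewrite vS in cardS.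
have := IH (S :\ v); rewrite (dedges_rec vS) => /(_ _ cSv) h.
have : (2 * #|S :\ v| <= dedges (S :\ v) + 2)%N by apply: h; lia.
lia.
Qed.

End EdgeCount.

(** [lia] restricted to the arithmetic hypotheses, with cardinals and edge counts abstracted to
    atoms. *)
Ltac card_lia :=
  repeat match goal with
  | H : is_true (leq _ _) |- _ => revert H
  | H : is_true (_ && _) |- _ => revert H
  | H : is_true (odd _) |- _ => revert H
  | H : is_true (~~ odd _) |- _ => revert H
  | H : @eq nat _ _ |- _ => revert H
  end; clear;
  repeat match goal with
  | |- context [card ?A] => generalize (card A)
  | |- context [dedges ?A] => generalize (dedges A)
  end; lia.

(** * Lower bounds by the star and by the triangle with pendant leaves *)

Section LowerBound.

Variables (G : sgraph) (R : realFieldType) (t : R) (P : {set G}).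
Implicit Types (S T A B C D : {set G}) (v : G).

Local Notation I S := (ipoly S (- t)).

Hypothesis t_ge0 : 0 <= t.
Hypothesis I_ge0 : forall S, S \subset P -> 0 <= I S.

Lemma ipoly_mono S T : S \subset P -> T \subset S -> I S <= I T.
Proof.
have [n] := ubnP #|S|; elim: n S => // n IH S leS sSP sTS.
have [->|neq] := eqVneq T S; first by [].
have /properP[_ [v vS vT]] : T \proper S by rewrite properEneq neq.
have cS := cardsD1 v S; rewrite vS in cS.
have sS' : S :\ v \subset P by apply: subset_trans sSP; apply: subsetDl.
apply: (@le_trans _ _ (I (S :\ v))).
  rewrite (ipoly_rec _ vS) mulNr gerBl mulr_ge0 // I_ge0 //.
  by apply: subset_trans sS'; apply: subsetDl.
by apply: IH => //; [card_lia | rewrite subsetD1 sTS].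
Qed.

Lemma ipoly_set1 v : I [set v] = 1 - t.
Proof.
rewrite (ipoly_rec _ (set11 v)) setDv set0D ipoly0; ring.
Qed.

Lemma one_sub_ge0 v : v \in P -> 0 <= 1 - t.
Proof. by move=> vP; rewrite -(ipoly_set1 v) I_ge0 // sub1set. Qed.

(** By monotonicity I((S - v) - N(v)) is at least I(S - v), so each vertex added costs a factor of
    at most 1 - t. *)
Lemma ipoly_le S T : S \subset P -> T \subset S ->
  I S <= (1 - t) ^+ #|S :\: T| * I T.
Proof.
have [n] := ubnP #|S|; elim: n S => // n IH S leS sSP sTS.
have [->|neq] := eqVneq T S; first by rewrite setDv cards0 mul1r.
have /properP[_ [v vS vT]] : T \proper S by rewrite properEneq neq.
have cS := cardsD1 v S; rewrite vS in cS.
have sS' : S :\ v \subset P by apply: subset_trans sSP; apply: subsetDl.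
rewrite (cardsD1 v (S :\: T)) inE vT vS exprS -mulrA.
have -> : (S :\: T) :\ v = (S :\ v) :\: T by rewrite setDDl setUC -setDDl.
apply: (@le_trans _ _ ((1 - t) * I (S :\ v))); last first.
  rewrite ler_wpM2l //; first by apply: one_sub_ge0 (subsetP sSP v vS).
  by apply: IH => //; [card_lia | rewrite subsetD1 sTS].
rewrite (ipoly_rec _ vS) mulrBl mul1r mulNr lerD2l lerN2 ler_wpM2l //.
by apply: ipoly_mono => //; apply: subsetDl.
Qed.

Lemma ipoly_edge u v : adj u v -> I [set u; v] = 1 - 2 * t.
Proof.
move=> uv; rewrite (ipoly_rec _ (set21 u v)).
have -> : [set u; v] :\ u = [set v].
  by rewrite setU1K // inE adj_neq.
have -> : [set v] :\: nbh u = set0.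
  by apply/eqP; rewrite setD_eq0 sub1set inE.
rewrite ipoly_set1 ipoly0; ring.
Qed.

Lemma card_remove S v : v \in S -> #|(S :\ v) :\: nbh v| = (#|S|.-1 - #|nbh v :&: S|)%N.
Proof.
move=> vS; rewrite cardsD (cardsD1 v S) vS /=; congr (_ - _)%N.
apply: eq_card => w; rewrite !inE andbC; case: eqP => [->|//].
by rewrite adj_irrefl.
Qed.

(** The bound is the value for the star on [#|S|] vertices. A non-cut vertex of a tree is a leaf;
    deleting it loses at most [t] times the value of an edgeless graph. *)
Lemma ipoly_tree_ge S : S \subset P -> conn S -> dedges S = (2 * #|S|.-1)%N ->
  (1 - t) ^+ #|S|.-1 - t <= I S.
Proof.
have [n] := ubnP #|S|; elim: n S => // n IH S leS sSP cS eS.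
have S0 : (0 < #|S|)%N by rewrite card_gt0 cS.1.
have [le1|gt1] := leqP #|S| 1.
  have /eqP/cards1P[v ->] : #|S| = 1%N by card_lia.
  by rewrite cards1 ipoly_set1.
have [v [vS cSv dv]] := conn_noncut cS gt1.
have cardS := cardsD1 v S; rewrite vS in cardS.
have sS' : S :\ v \subset P by apply: subset_trans sSP; apply: subsetDl.
have := conn_dedges cSv; move: eS; rewrite (dedges_rec vS) => eS geS.
have d1 : #|nbh v :&: S| = 1%N by card_lia.
have h1 : (1 - t) ^+ #|S :\ v|.-1 - t <= I (S :\ v) by apply: IH => //; card_lia.
set S2 := (S :\ v) :\: nbh v.
have cS2 : #|S2| = #|S|.-2 by rewrite card_remove // d1; card_lia.
have h2 : I S2 <= (1 - t) ^+ #|S2|.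
  have := @ipoly_le S2 set0; rewrite setD0 ipoly0 mulr1; apply; rewrite ?sub0set //.
  by apply: subset_trans sS'; apply: subsetDl.
rewrite (ipoly_rec _ vS) -/S2 mulNr.
have -> : #|S|.-1 = #|S|.-2.+1 by card_lia.
have e1 : #|S :\ v|.-1 = #|S|.-2 by card_lia.
rewrite e1 in h1; rewrite cS2 in h2.
have := ler_wpM2l t_ge0 h2; rewrite exprS => h3; lra.
Qed.

(** The bound is the value for [Un]. The edge count leaves degree 1 or 2 for a non-cut vertex. In
    degree 2 its removal leaves a tree; in degree 1 the induction continues, and the subtracted term
    is kept small by an edge surviving in [S2]. *)
Lemma ipoly_unicyclic_ge S : S \subset P -> conn S -> dedges S = (2 * #|S|)%N ->
  (1 - 2 * t) * (1 - t) ^+ (#|S| - 3) - t <= I S.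
Proof.
have [n] := ubnP #|S|; elim: n S => // n IH S leS sSP cS eS.
have S0 : (0 < #|S|)%N by rewrite card_gt0 cS.1.
have gt2 : (2 < #|S|)%N.
  have := dedges_leq S; rewrite eS.
  case: #|S| S0 => [|[|[|]]] //.
have [v [vS cSv dv]] := conn_noncut cS (ltnW gt2).
have cardS := cardsD1 v S; rewrite vS in cardS.
have sS' : S :\ v \subset P by apply: subset_trans sSP; apply: subsetDl.
have := conn_dedges cSv; have eS' := eS; rewrite (dedges_rec vS) in eS' => geS.
set S2 := (S :\ v) :\: nbh v.
have sS2 : S2 \subset P by apply: subset_trans sS'; apply: subsetDl.
have vP : v \in P := subsetP sSP v vS.
have r0 := one_sub_ge0 vP.
rewrite (ipoly_rec _ vS) -/S2 mulNr.
have [d1|d2] : #|nbh v :&: S| = 1%N \/ #|nbh v :&: S| = 2%N by card_lia.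
  have h1 : (1 - 2 * t) * (1 - t) ^+ (#|S :\ v| - 3) - t <= I (S :\ v).
    by apply: IH => //; card_lia.
  have gt3 : (2 < #|S :\ v|)%N.
    have := dedges_leq (S :\ v); have -> : dedges (S :\ v) = (2 * #|S :\ v|)%N.
      by card_lia.
    have : (0 < #|S :\ v|)%N by card_lia.
    case: #|S :\ v| => [|[|[|]]] //.
  have cS2 : #|S2| = #|S|.-2 by rewrite card_remove // d1; card_lia.
  have /eqP/cards1P[u eu] := d1.
  have : u \in nbh v :&: S by rewrite eu set11.
  rewrite !inE => /andP[vu uS].
  have uSv : u \in S :\ v by rewrite !inE uS eq_sym adj_neq.
  have eS2 : S2 = (S :\ v) :\ u.
    apply/setP => w; rewrite !inE; have := congr1 (fun A : {set G} => w \in A) eu.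
    rewrite !inE => <-; by case: (w \in S); rewrite ?andbF ?andbT.
  (* [S :\ v] spans [#|S|.-1] edges, and [u] lies on at most [#|S|.-2] of them. *)
  have d2 : (0 < dedges S2)%N.
    have : dedges (S :\ v) = (dedges S2 + 2 * #|nbh u :&: (S :\ v)|)%N.
      by rewrite eS2 -dedges_rec.
    have : (#|nbh u :&: (S :\ v)| <= #|S2|)%N.
      apply: subset_leq_card; rewrite eS2; apply/subsetP => w.
      by rewrite !inE => /andP[/adj_neq]; rewrite eq_sym => -> ->.
    move: cardS eS' d1 gt2; rewrite cS2; clear; card_lia.
  have [a [b [aS2 bS2 ab]]] : exists a b, [/\ a \in S2, b \in S2 & adj a b].
    have [/exists_inP[a aS2 /exists_inP[b bS2 ab]]|/exists_inPn h] :=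
        boolP [exists a in S2, exists b in S2, adj a b]; first by exists a, b.
    move: d2; rewrite /dedges big1 // => a aS2; apply/eqP; rewrite cards_eq0.
    apply/eqP/setP => b; rewrite !inE; apply/negP => /andP[ab bS2].
    by have /exists_inPn/(_ b) := h a aS2; rewrite ab !inE => /(_ bS2).
  have sab : [set a; b] \subset S2 by rewrite subUset !sub1set aS2.
  have h2 := ipoly_le sS2 sab.
  move: h2; rewrite (ipoly_edge ab) cardsD (setIidPr sab) cards2 adj_neq // cS2.
  have -> : (#|S|.-2 - 2 = #|S :\ v| - 3)%N by card_lia.
  have -> : (#|S| - 3 = (#|S :\ v| - 3).+1)%N by card_lia.
  move=> /(ler_wpM2l t_ge0) h2; rewrite exprS; move: h1 h2.
  set X := _ ^+ _; move=> h1 h2; lra.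
have h1 : (1 - t) ^+ #|S :\ v|.-1 - t <= I (S :\ v).
  by apply: ipoly_tree_ge => //; card_lia.
have cS2 : #|S2| = (#|S| - 3)%N by rewrite card_remove // d2; card_lia.
have h2 : I S2 <= (1 - t) ^+ #|S2|.
  by have := @ipoly_le S2 set0; rewrite setD0 ipoly0 mulr1; apply; rewrite ?sub0set.
move: h1 (ler_wpM2l t_ge0 h2); rewrite cS2.
have -> : #|S :\ v|.-1 = (#|S| - 3).+1 by card_lia.
rewrite exprS; set X := _ ^+ _; move=> h1 h3; lra.
Qed.

End LowerBound.

(** * Upper bound by C_n *)

Section LinearRecurrence.

Variables (R : comNzRingType) (t : R).

Fixpoint linrec (a b : R) (k : nat) : R :=
  match k with
  | 0 => a
  | k1.+1 => if k1 is k2.+1 then linrec a b k1 - t * linrec a b k2 else b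
  end.

Lemma linrecSS a b k : linrec a b k.+2 = linrec a b k.+1 - t * linrec a b k.
Proof. by []. Qed.

(* At t, the path with k vertices has independence polynomial fib k.+2 and the
   cycle with k vertices has luc k. *)
Definition fib := linrec 0 1.
Definition luc := linrec 2 1.

(** Addition formula for arbitrary initial values; two consecutive [j] are carried because the
    recurrence has order two. *)
Lemma linrec_add a b i j :
  linrec a b (i + j).+1 = linrec a b i.+1 * fib j.+1 - t * linrec a b i * fib j.
Proof.
suff [] : linrec a b (i + j).+1
            = linrec a b i.+1 * fib j.+1 - t * linrec a b i * fib j /\
          linrec a b (i + j.+1).+1
            = linrec a b i.+1 * fib j.+2 - t * linrec a b i * fib j.+1 by [].
elim: j => [|j [IH1 IH2]].
  rewrite addn0 addn1 linrecSS /fib /=; split; ring.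
split=> //; rewrite addnS linrecSS IH2 addnS IH1 /fib !linrecSS; ring.
Qed.

(** With nonnegative terms this says that the ratio s(i+2) / s(i+1) times the path ratio fib(j+2) /
    fib(j+1) is at most s(i+j+2) / s(i+j+1): merging two components into one only raises the
    bound. *)
Lemma linrec_submul a b i j (s := linrec a b) :
  s i.+2 * fib j.+2 * s (i + j).+1 + t * s (i + j).+3 * s i * fib j
  = s (i + j).+2 * s i.+1 * fib j.+1.
Proof.
have e1 := linrec_add a b i j.
have e2 : s (i + j).+2 = s i.+2 * fib j.+1 - t * s i.+1 * fib j.
  by rewrite /s -addSn linrec_add.
have e3 : s (i + j).+3 = s i.+2 * fib j.+2 - t * s i.+1 * fib j.+1.
  by rewrite /s -addSn -addnS linrec_add.
rewrite e3 e2 /s e1 /fib !linrecSS; ring.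
Qed.

Lemma lucE k : luc k = 2 * fib k.+1 - fib k.
Proof.
suff [] : luc k = 2 * fib k.+1 - fib k /\ luc k.+1 = 2 * fib k.+2 - fib k.+1 by [].
elim: k => [|k [IH1 IH2]]; first by rewrite /luc /fib /=; split; ring.
split=> //; rewrite /luc linrecSS -/luc IH1 IH2 /fib !linrecSS; ring.
Qed.

(** The nonnegative right-hand side gives fib(k+4) / fib(k+2) <= luc(k+2) / luc(k+1): a path
    deprived of both ends against the ratio wanted in [two_hits]. *)
Lemma luc_fib_double k :
  luc k.+2 * fib k.+2 - luc k.+1 * fib k.+4 = t * luc k.+3 * fib k.
Proof. rewrite !lucE /fib !linrecSS; ring. Qed.

Lemma luc_cassini k : luc k * fib k.+2 = luc k.+1 * fib k.+1 + t ^+ k.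
Proof.
elim: k => [|k IH]; first by rewrite /luc /fib /=; ring.
rewrite exprS; have -> : t ^+ k = luc k * fib k.+2 - luc k.+1 * fib k.+1.
  by rewrite IH; ring.
rewrite [fib k.+3]linrecSS [luc k.+2]linrecSS -/(fib k.+2) -/(fib k.+1) -/(luc k.+1) -/(luc k).
ring.
Qed.

End LinearRecurrence.

(** * Components and sets meeting all of them *)

Section Splitting.

Variable G : sgraph.
Implicit Types (S T A B C D W N : {set G}) (v : G).

Lemma conn_or_split W : W != set0 ->
  conn W \/ exists C D, [/\ C != set0, D != set0, W = C :|: D,
    [disjoint C & D] & forall a b, a \in C -> b \in D -> ~~ adj a b].
Proof.
move=> W0.
have [/existsP[C /and4P[sCW C0 CW /forallP clC]]|/existsPn h] := boolP [exists C : {set G},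
    [&& C \subset W, C != set0, C != W &
        [forall x, forall y, (x \in C) && (y \in W) && adj x y ==> (y \in C)]]].
  right; exists C, (W :\: C); split => //.
  - by rewrite setD_eq0; apply: contra CW => sWC; rewrite eqEsubset sCW.
  - by rewrite -{1}(setIidPr sCW) setID.
  - by rewrite disjoint_sym disjoints_subset; apply/subsetP => x; rewrite !inE => /andP[].
  - move=> a b aC; rewrite inE => /andP[bC bW]; apply: contra bC => ab.
    by have /forallP/(_ b)/implyP := clC a; apply; rewrite aC bW.
left; split=> // C sCW C0 clC; apply/eqP; apply: contraT => CW.
have := h C; rewrite sCW C0 CW /= => /negP[]; apply/forallP => x; apply/forallP => y.
by apply/implyP => /andP[/andP[xC yW]] xy; apply: clC xy.
Qed.

(* N meets every connected component of W. *)
Definition hits W N : Prop :=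
  forall C, C \subset W -> C != set0 -> closed_in W C ->
  exists u, (u \in C) && (u \in N).

Lemma hits_closed W N C : C \subset W -> closed_in W C -> hits W N -> hits C N.
Proof.
move=> sCW clC hW A sAC A0 clA; apply: hW => //; first exact: subset_trans sCW.
move=> x y xA yW xy; apply: (clA x) => //.
by apply: (clC x) => //; apply: (subsetP sAC).
Qed.

Lemma closed_inUl C D :
  (forall a b, a \in C -> b \in D -> ~~ adj a b) -> closed_in (C :|: D) C.
Proof.
move=> nCD x y xC; rewrite inE => /orP[//|yD] xy.
by have := nCD x y xC yD; rewrite xy.
Qed.

Lemma closed_inUr C D :
  (forall a b, a \in C -> b \in D -> ~~ adj a b) -> closed_in (C :|: D) D.
Proof.
by move=> nCD; rewrite setUC; apply: closed_inUl => a b aD bC; rewrite adj_sym nCD.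
Qed.

(** A part closed in [W :\ u] that avoids the neighbours of [u] would be closed in [W]. *)
Lemma hits_nbh W u : conn W -> u \in W -> hits (W :\ u) (nbh u).
Proof.
move=> [_ cW] uW C sC C0 clC.
have [|h] := boolP [exists x, (x \in C) && (x \in nbh u)]; first by move/existsP.
have uC : u \notin C by apply/negP => /(subsetP sC); rewrite setD11.
have sCW : C \subset W by apply: subset_trans sC _; apply: subsetDl.
have eC : C = W.
  apply: cW => // x y xC yW xy; apply: (clC x) => //; rewrite !inE yW andbT.
  apply: contraNneq h => ey; apply/existsP; exists x.
  by rewrite xC inE adj_sym -ey.
by move: uC; rewrite eC uW.
Qed.

Lemma dedgesU C D :
    [disjoint C & D] -> (forall a b, a \in C -> b \in D -> ~~ adj a b) ->
  dedges (C :|: D) = (dedges C + dedges D)%N.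
Proof.
move=> dCD nCD; rewrite /dedges (eq_bigl [in [predU C & D]]) => [|i]; last first.
  by rewrite !inE.
rewrite bigU //=.
congr (_ + _)%N; apply: eq_bigr => a ain; apply: eq_card => b; rewrite !inE.
  have [ab|//] := boolP (adj a b); rewrite /=.
  by case: (boolP (b \in D)) => [/(nCD a b ain)|]; rewrite ?ab ?orbF.
have [ab|//] := boolP (adj a b); rewrite /=.
case: (boolP (b \in C)) => [/nCD/(_ ain)|//]; first by rewrite adj_sym ab.
Qed.

Lemma component W u : u \in W ->
  exists C, [/\ C \subset W, u \in C, conn C & closed_in W C].
Proof.
have [n] := ubnP #|W|; elim: n W => // n IH W leW uW.
have W0 : W != set0 by apply/set0Pn; exists u.
have [cW|[C [D [C0 D0 eW dCD nCD]]]] := conn_or_split W0.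
  by exists W; split.
have cardW : #|W| = (#|C| + #|D|)%N by rewrite eW cardsU disjoint_setI0 // cards0 subn0.
move: C0 D0; rewrite -!card_gt0 => C0 D0.
have fin A : (#|A| < n)%N -> u \in A -> A \subset W -> closed_in W A ->
    exists C, [/\ C \subset W, u \in C, conn C & closed_in W C].
  move=> ltA uA sA clA; have [A' [sA' uA' cA' clA']] := IH A ltA uA.
  exists A'; split => //; first exact: subset_trans sA.
  move=> x y xA' yW xy; apply: (clA' x) => //; apply: (clA x) => //.
  exact: (subsetP sA').
move: uW; rewrite {1}eW inE => /orP[uC|uD].
  apply: (fin C) => //; first by card_lia.
    by rewrite eW subsetUl.
  by rewrite eW; apply: closed_inUl.
apply: (fin D) => //; first by card_lia.
  by rewrite eW subsetUr.
by rewrite eW; apply: closed_inUr.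
Qed.

End Splitting.

(** * Ratio bounds at the first zero of the cycle *)

Section UpperBound.

Variables (G : sgraph) (R : realFieldType) (t : R) (n : nat) (P : {set G}).
Implicit Types (S T A B C D W N : {set G}) (v : G).

Local Notation I S := (ipoly S (- t)).
Local Notation F := (fib t).
Local Notation L := (luc t).

(** The situation to be refuted: [t] is the first zero for the cycle, hence paths with fewer than
    [n] vertices are positive there, while all induced subgraphs of [P], including [P] itself, are
    positive too. *)
Hypothesis n_gt2 : (2 < n)%N.
Hypothesis t_gt0 : 0 < t.
Hypothesis I_gt0 : forall S, S \subset P -> 0 < I S.
Hypothesis F_gt0 : forall k, (0 < k <= n.+1)%N -> 0 < F k.
Hypothesis Ln : L n = 0.

(** Downward induction from [L n = 0], each step by [luc_cassini]. *)
Lemma luc_gt0 k : (k < n)%N -> 0 < L k.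
Proof.
have h m : (m < n)%N -> 0 <= L m.+1 -> 0 < L m.
  move=> ltm ge0; rewrite -(@pmulr_lgt0 _ (F m.+2)); last by apply: F_gt0; card_lia.
  rewrite luc_cassini ltr_wpDl ?exprn_gt0 // mulr_ge0 // ltW // F_gt0 //; card_lia.
move=> ltk; rewrite -(subKn (ltnW ltk)).
have : (0 < n - k <= n)%N by card_lia.
elim: (n - k)%N => // m IH /andP[_ lem].
apply: h; first by card_lia.
rewrite -subSn // subSS.
have [->|m0] := posnP m; first by rewrite subn0 Ln.
by apply/ltW/IH; rewrite m0; card_lia.
Qed.

Lemma luc_ge0 k : (k <= n)%N -> 0 <= L k.
Proof. by rewrite leq_eqVlt => /predU1P[->|/luc_gt0/ltW //]; rewrite Ln. Qed.

Lemma fib_ge0 k : (k <= n.+2)%N -> 0 <= F k.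
Proof.
rewrite leq_eqVlt => /predU1P[->|lek]; last first.
  have [->|k0] := posnP k; first by rewrite lexx.
  by apply/ltW/F_gt0; rewrite k0.
have e := Ln; rewrite lucE in e.
(* The path on [n] vertices is beyond [F_gt0]. From [L n = 0] comes F n = 2 F(n+1), and 1 - 2t is
   [L 2], positive because 2 < n. *)
have -> : F n.+2 = (1 - 2 * t) * F n.+1.
  rewrite /fib linrecSS -/(F n.+1) -/(F n).
  have -> : F n = 2 * F n.+1 by apply/eqP; rewrite eq_sym -subr_eq0 e.
  ring.
apply: mulr_ge0; last by apply/ltW/F_gt0; card_lia.
have := luc_ge0 n_gt2; have := luc_gt0 n_gt2; rewrite /luc /= => h _; lra.
Qed.

Lemma fib_mono k : (0 < k <= n.+1)%N -> F k.+1 <= F k.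
Proof.
case: k => // k /andP[_ lek]; rewrite /fib linrecSS -/(F k.+1) -/(F k).
by rewrite gerBl mulr_ge0 ?(ltW t_gt0) // fib_ge0; card_lia.
Qed.

(** Product of two ratio bounds without division: x/x' <= p'/p, y/y' <= q'/q and (p'/p)(q'/q) <=
    r'/r give xy/(x'y') <= r'/r. *)
Lemma split_le (x x' y y' p p' q q' r r' : R) :
    0 < p -> 0 < q -> 0 <= r -> 0 <= p' -> 0 <= q' -> 0 <= x -> 0 <= y ->
    0 <= x' -> 0 <= y' ->
    p * x <= p' * x' -> q * y <= q' * y' -> p' * q' * r <= r' * p * q ->
  r * (x * y) <= r' * (x' * y').
Proof.
move=> p0 q0 r0 p'0 q'0 x0 y0 x'0 y'0 hx hy hr.
have pq0 : 0 < p * q by rewrite mulr_gt0.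
rewrite -(ler_pM2l pq0).
apply: (@le_trans _ _ (r * ((p' * x') * (q' * y')))).
  have -> : p * q * (r * (x * y)) = r * ((p * x) * (q * y)) by ring.
  by rewrite ler_wpM2l // ler_pM // mulr_ge0 // ltW.
have -> : r * ((p' * x') * (q' * y')) = (p' * q' * r) * (x' * y') by ring.
have -> : p * q * (r' * (x' * y')) = (r' * p * q) * (x' * y') by ring.
by rewrite ler_wpM2r // mulr_ge0.
Qed.

(** One step of a continued fraction: if the ratio after deleting [u] is at most x/y, then I(W) /
    I(W - u) is at most 1 - t y/x. For consecutive terms of a [linrec] sequence this is the next
    ratio. *)
Lemma conn_step W u (x y : R) : W \subset P -> u \in W -> 0 <= x ->
    y * I (W :\ u) <= x * I ((W :\ u) :\: nbh u) ->
  x * I W <= (x - t * y) * I (W :\ u).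
Proof.
move=> sW uW x0 h; rewrite (ipoly_rec _ uW) mulNr mulrBr mulrBl lerD2l lerN2.
by rewrite -mulrA [leRHS]mulrCA ler_pM2l.
Qed.

(* The path rooted at an end has the largest ratio I(W) / I(W - N). *)
Lemma ipoly_hits W N : W \subset P -> (#|W| < n)%N -> hits W N ->
  F #|W|.+1 * I W <= F #|W|.+2 * I (W :\: N).
Proof.
have [m] := ubnP #|W|; elim: m W N => // m IH W N leW sWP ltn hW.
have [->|W0] := eqVneq W set0.
  by rewrite set0D cards0 !ipoly0 /fib /= mulr0 subr0.
have [cW|[C [D [C0 D0 eW dCD nCD]]]] := conn_or_split W0.
  have [|u /andP[uW uN]] := hW W (subxx _) W0; first by move=> x y.
  have cardW := cardsD1 u W; rewrite uW in cardW.
  have sW' : W :\ u \subset P by apply: subset_trans sWP; apply: subsetDl.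
  (* The neighbours of [u] take over the role of [N] for [W :\ u]. Deleting all of [N] instead of
     just [u] can only increase the value. *)
  have hu : F #|W| * I (W :\ u) <= F #|W|.+1 * I ((W :\ u) :\: nbh u).
    by rewrite cardW; apply: IH => //; [card_lia | card_lia | exact: hits_nbh].
  apply: le_trans (conn_step sWP uW _ hu) _; first by apply: fib_ge0; card_lia.
  rewrite -[_ - _]linrecSS -/(F #|W|.+2); apply: ler_wpM2l; first by apply: fib_ge0; card_lia.
  apply: (ipoly_mono (ltW t_gt0)) sW' _; last by apply: setDS; rewrite sub1set.
  by move=> S /I_gt0/ltW.
have sCW : C \subset W by rewrite eW subsetUl.
have sDW : D \subset W by rewrite eW subsetUr.
have sCP := subset_trans sCW sWP; have sDP := subset_trans sDW sWP.
have clC : closed_in W C by rewrite eW; apply: closed_inUl.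
have clD : closed_in W D by rewrite eW; apply: closed_inUr.
have cardW : #|W| = (#|C| + #|D|)%N by rewrite eW cardsU disjoint_setI0 // cards0 subn0.
move: C0 D0; rewrite -!card_gt0 => C0 D0.
have hC : F #|C|.+1 * I C <= F #|C|.+2 * I (C :\: N).
  by apply: IH => //; [card_lia | card_lia | exact: hits_closed hW].
have hD : F #|D|.+1 * I D <= F #|D|.+2 * I (D :\: N).
  by apply: IH => //; [card_lia | card_lia | exact: hits_closed hW].
have -> : I W = I C * I D by rewrite eW ipolyU.
have -> : I (W :\: N) = I (C :\: N) * I (D :\: N).
  rewrite eW setDUl ipolyU //.
    by apply: disjointWl (subsetDl _ _) _; apply: disjointWr (subsetDl _ _) _.
  by move=> a b /setDP[aC _] /setDP[bD _]; apply: nCD.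
have I0 S : S \subset P -> 0 <= I S by move=> /I_gt0/ltW.
have I0D S : S \subset P -> 0 <= I (S :\: N).
  by move=> sS; apply/I0/(subset_trans _ sS)/subsetDl.
apply: (split_le _ _ _ _ _ _ _ _ _ hC hD); rewrite ?I0D ?I0 //.
- by apply: F_gt0; card_lia.
- by apply: F_gt0; card_lia.
- by apply: fib_ge0; card_lia.
- by apply: fib_ge0; card_lia.
- by apply: fib_ge0; card_lia.
rewrite cardW -[leRHS](linrec_submul t 0 1) lerDl.
have F0 k : (k <= n.+2)%N -> 0 <= linrec t 0 1 k by exact: fib_ge0.
by rewrite !mulr_ge0 ?(ltW t_gt0) ?fib_ge0 ?F0 //; card_lia.
Qed.

(** Splitting [W :\ u] into the component [C] of [u'] and the rest [D] shows that the quotient is at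
    most that of a path of the same order deprived of its two ends; [luc_fib_double] then compares
    this with [luc]. *)
Lemma two_hits W u u' : W \subset P -> conn W -> (#|W| < n)%N ->
    u \in W -> u' \in W -> u' != u ->
  L #|W|.-1 * I W <= L #|W| * I (W :\: [set u; u']).
Proof.
move=> sWP cW ltn uW u'W neu; have cardW := cardsD1 u W; rewrite uW in cardW.
have u'W' : u' \in W :\ u by rewrite !inE neu.
have [C [sC u'C cC clC]] := component u'W'.
pose D := (W :\ u) :\: C.
have eW : W :\ u = C :|: D by rewrite -{1}(setIidPr sC) setID.
have dCD : [disjoint C & D].
  by rewrite disjoint_sym disjoints_subset; apply/subsetP => x; rewrite !inE => /andP[].
have nCD a b : a \in C -> b \in D -> ~~ adj a b.
  move=> aC; rewrite inE => /andP[bC bW]; apply: contra bC; exact: clC.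
have cardCD : #|W :\ u| = (#|C| + #|D|)%N.
  by rewrite eW cardsU disjoint_setI0 // cards0 subn0.
have sD : D \subset W :\ u by apply: subsetDl.
have sW' : W :\ u \subset P by apply: subset_trans sWP; apply: subsetDl.
have sCP := subset_trans sC sW'; have sDP := subset_trans sD sW'.
have hits_u := hits_nbh cW uW.
have clD : closed_in (W :\ u) D by rewrite eW; apply: closed_inUr.
have C0 : (0 < #|C|)%N by rewrite card_gt0 cC.1.
have hC : F #|C|.+1 * I C <= F #|C|.+2 * I (C :\: nbh u).
  by apply: ipoly_hits => //; [card_lia | exact: hits_closed hits_u].
have hD : F #|D|.+1 * I D <= F #|D|.+2 * I (D :\: nbh u).
  by apply: ipoly_hits => //; [card_lia | exact: hits_closed hits_u].
have hC' : F #|C|.+1 * I C <= F #|C|.+2 * I (C :\ u').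
  apply: ipoly_hits => //; first by card_lia.
  by move=> A sA A0 clA; exists u'; rewrite (cC.2 A) // u'C set11.
have Iu : I W = I C * I D - t * (I (C :\: nbh u) * I (D :\: nbh u)).
  rewrite (ipoly_rec _ uW) mulNr; congr (_ - _ * _); first by rewrite eW ipolyU.
  rewrite eW setDUl ipolyU //.
    by apply: disjointWl (subsetDl _ _) _; apply: disjointWr (subsetDl _ _) _.
  by move=> a b /setDP[aC _] /setDP[bD _]; apply: nCD.
have Iuu : I (W :\: [set u; u']) = I (C :\ u') * I D.
  rewrite -setDDl eW setDUl.
  have -> : D :\ u' = D.
    by apply/setDidPl; rewrite disjoint_sym disjoints1 (disjointFr dCD u'C).
  rewrite ipolyU //; first by apply: disjointWl (subsetDl _ _) _.
  by move=> a b /setDP[aC _]; apply: nCD.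
have IW0 := I_gt0 sWP; rewrite Iuu; rewrite {}Iu in IW0 *.
have := I_gt0 sCP; have := I_gt0 sDP.
have := @I_gt0 (C :\: nbh u) (subset_trans (subsetDl _ _) sCP).
have := @I_gt0 (D :\: nbh u) (subset_trans (subsetDl _ _) sDP).
have := @I_gt0 (C :\ u') (subset_trans (subsetDl _ _) sCP).
move: hC hD hC' IW0; set x := I C; set y := I D; set x1 := I (C :\: _).
set y1 := I (D :\: _); set x' := I (C :\ _).
set a := #|C| in C0 cardCD *; set b := #|D| in cardCD *.
set X := x * y - _ => hC hD hC' X0 x'0 y10 x10 y0 x0.
have ek : #|W| = (a + b).+1 by card_lia.
rewrite ek /=.
have Fa1 : 0 < F a.+1 by apply: F_gt0; card_lia.
have Fa2 : 0 < F a.+2 by apply: F_gt0; card_lia.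
have Fb1 : 0 < F b.+1 by apply: F_gt0; card_lia.
have Fb2 : 0 < F b.+2 by apply: F_gt0; card_lia.
have Fk : 0 < F (a + b).+1 by apply: F_gt0; card_lia.
have Fk2 : 0 <= F (a + b).+3 by apply: fib_ge0; card_lia.
have eF3 : F (a + b).+3 = F a.+2 * F b.+2 - t * F a.+1 * F b.+1.
  by rewrite /fib -addSn -addnS linrec_add.
(* Deleting [u] is compared with deleting from a path the vertex that leaves [a] vertices on one
   side and [b] on the other. *)
have h1 : F a.+2 * F b.+2 * X <= F (a + b).+3 * (x * y).
  have : (F a.+1 * x) * (F b.+1 * y) <= (F a.+2 * x1) * (F b.+2 * y1).
    by rewrite ler_pM // mulr_ge0 // ltW.
  move=> /(ler_wpM2l (ltW t_gt0)); rewrite eF3 /X => h.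
  rewrite -subr_ge0; rewrite -subr_ge0 in h; apply: le_trans h _.
  by rewrite le_eqVlt; apply/orP; left; apply/eqP; ring.
have h2 : F a.+1 * F b.+2 * X <= F (a + b).+3 * (x' * y).
  rewrite -(ler_pM2l Fa2).
  apply: (@le_trans _ _ (F a.+1 * (F (a + b).+3 * (x * y)))).
    have -> : F a.+2 * (F a.+1 * F b.+2 * X) = F a.+1 * (F a.+2 * F b.+2 * X) by ring.
    by rewrite ler_pM2l.
  have -> : F a.+1 * (F (a + b).+3 * (x * y)) = F (a + b).+3 * y * (F a.+1 * x) by ring.
  have -> : F a.+2 * (F (a + b).+3 * (x' * y)) = F (a + b).+3 * y * (F a.+2 * x') by ring.
  by apply: ler_wpM2l hC'; rewrite mulr_ge0 // ltW.
(* Moves the two deleted vertices to the ends: the paths with a - 1 and b vertices are joined into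
   one, which does not increase the value. *)
have h3 : F (a + b).+1 <= F a.+1 * F b.+2.
  rewrite /fib linrec_add -/(F a.+1) -/(F b.+1) -/(F a) -/(F b) linrecSS -/(F b.+1) -/(F b).
  rewrite mulrBr lerD2l lerN2 mulrCA mulrA ler_wpM2r //; first by apply: fib_ge0; card_lia.
  by rewrite ler_pM2l //; apply: fib_mono; card_lia.
have h4 : F (a + b).+1 * X <= F (a + b).+3 * (x' * y).
  by apply: le_trans h2; rewrite ler_pM2r.
rewrite -(ler_pM2l Fk).
have L0 : 0 <= L (a + b) by apply: luc_ge0; card_lia.
have := ler_wpM2l L0 h4.
have -> : F (a + b).+1 * (L (a + b) * X) = L (a + b) * (F (a + b).+1 * X) by ring.
move=> /le_trans; apply.
rewrite [leLHS]mulrA [leRHS]mulrA; apply: ler_wpM2r; first by rewrite mulr_ge0 // ltW.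
have -> : (a + b)%N = (a.-1 + b).+1 by card_lia.
rewrite [leRHS]mulrC -subr_ge0 luc_fib_double.
rewrite !mulr_ge0 ?(ltW t_gt0) //; first by apply: luc_ge0; card_lia.
by apply: fib_ge0; card_lia.
Qed.

(* The last hypothesis says that a component of W contains a cycle or meets N
   twice. The ratio luc k / luc k.-1 is that of a triangle with a pendant path,
   rooted at the end of the path. *)
Lemma ipoly_double_hits W N : W \subset P -> (#|W| < n)%N -> hits W N ->
    (2 * #|W| + 2 <= dedges W + 2 * #|N :&: W|)%N ->
  L #|W|.-1 * I W <= L #|W| * I (W :\: N).
Proof.
have [m] := ubnP #|W|; elim: m W N => // m IH W N leW sWP ltn hW eW.
have [W0|W0] := eqVneq W set0.
  by move: eW; rewrite W0 dedges0 setI0 !cards0.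
have I0 S : S \subset P -> 0 <= I S by move=> /I_gt0/ltW.
have I0D S : S \subset P -> 0 <= I (S :\: N).
  by move=> sS; apply/I0/(subset_trans _ sS)/subsetDl.
have [cW|[C [D [C0 D0 defW dCD nCD]]]] := conn_or_split W0.
  have [|u /andP[uW uN]] := hW W (subxx _) W0; first by move=> x y.
  have cardW := cardsD1 u W; rewrite uW in cardW.
  have sW' : W :\ u \subset P by apply: subset_trans sWP; apply: subsetDl.
  (* If [W] contains a cycle, the edges at [u] become hits, and the counting hypothesis passes to
     [W :\ u] with [nbh u] as it stands. Otherwise [W] is a tree and meets [N] in a second
     vertex. *)
  have [le2|gt2] := leqP (2 * #|W|) (dedges W).
    have hu : L #|W|.-2 * I (W :\ u) <= L #|W|.-1 * I ((W :\ u) :\: nbh u).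
      have -> : #|W|.-1 = #|W :\ u| by card_lia.
      apply: IH => //; [card_lia | card_lia | exact: hits_nbh | ].
      have := dedges_rec uW.
      have -> : nbh u :&: (W :\ u) = nbh u :&: W.
        apply/setP => w; rewrite !inE; case: eqP => [->|//].
        by rewrite adj_irrefl.
      card_lia.
    apply: le_trans (conn_step sWP uW _ hu) _; first by apply: luc_ge0; card_lia.
    have gt1 : (1 < #|W|)%N.
      have := dedges_leq W; have : (0 < #|W|)%N by rewrite card_gt0.
      by move: le2; case: #|W| => [|[|]] //; card_lia.
    have {1}-> : #|W|.-1 = #|W|.-2.+1 by card_lia.
    rewrite -[_ - _]linrecSS -/(L #|W|.-2.+2).
    have -> : #|W|.-2.+2 = #|W| by card_lia.
    apply: ler_wpM2l; first by apply: luc_ge0; card_lia.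
    apply: (ipoly_mono (ltW t_gt0)) sW' _ => //.
    by apply: setDS; rewrite sub1set.
  have [u' u'N] : exists u', u' \in (N :&: W) :\ u.
    by apply/set0Pn; rewrite -card_gt0; have := cardsD1 u (N :&: W); rewrite inE uN uW; card_lia.
  move: u'N; rewrite !inE => /and3P[neu u'N u'W].
  apply: le_trans (two_hits sWP cW ltn uW u'W neu) _.
  apply: ler_wpM2l; first by apply: luc_ge0; card_lia.
  apply: (ipoly_mono (P := P) (ltW t_gt0)) => //.
    by apply: subset_trans sWP; apply: subsetDl.
  by apply: setDS; rewrite subUset !sub1set uN.
(* Only one part has to satisfy the count: it contributes a [luc] ratio, the other part the [fib]
   ratio of a set that is merely hit. *)
have one C' D' : W = C' :|: D' -> [disjoint C' & D'] ->
    (forall a b, a \in C' -> b \in D' -> ~~ adj a b) -> D' != set0 ->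
    (2 * #|C'| + 2 <= dedges C' + 2 * #|N :&: C'|)%N ->
  L #|W|.-1 * I W <= L #|W| * I (W :\: N).
  move=> {}defW {}dCD {}nCD {}D0 exC.
  have sCW : C' \subset W by rewrite defW subsetUl.
  have sDW : D' \subset W by rewrite defW subsetUr.
  have sCP := subset_trans sCW sWP; have sDP := subset_trans sDW sWP.
  have clC : closed_in W C' by rewrite defW; apply: closed_inUl.
  have clD : closed_in W D' by rewrite defW; apply: closed_inUr.
  have cardW : #|W| = (#|C'| + #|D'|)%N.
    by rewrite defW cardsU disjoint_setI0 // cards0 subn0.
  move: D0; rewrite -!card_gt0 => D0'.
  have hC : L #|C'|.-1 * I C' <= L #|C'| * I (C' :\: N).
    by apply: IH => //; [card_lia | card_lia | exact: hits_closed hW].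
  have hD : F #|D'|.+1 * I D' <= F #|D'|.+2 * I (D' :\: N).
    by apply: ipoly_hits => //; [card_lia | exact: hits_closed hW].
  have gt1 : (1 < #|C'|)%N.
    have := dedges_leq C'; have := subset_leq_card (subsetIr N C').
    by case: #|C'| exC => [|[|]] //; card_lia.
  have -> : I W = I C' * I D' by rewrite defW ipolyU.
  have -> : I (W :\: N) = I (C' :\: N) * I (D' :\: N).
    rewrite defW setDUl ipolyU //.
      by apply: disjointWl (subsetDl _ _) _; apply: disjointWr (subsetDl _ _) _.
    by move=> a b /setDP[aC _] /setDP[bD _]; apply: nCD.
  have eC : #|C'| = #|C'|.-2.+2 by card_lia.
  apply: (split_le _ _ _ _ _ _ _ _ _ hC hD); rewrite ?I0D ?I0 //.
  - by apply: luc_gt0; card_lia.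
  - by apply: F_gt0; card_lia.
  - by apply: luc_ge0; card_lia.
  - by apply: luc_ge0; card_lia.
  - by apply: fib_ge0; card_lia.
  rewrite cardW eC !addSn /= -[leRHS](linrec_submul t 2 1) lerDl.
  have L0 k : (k <= n)%N -> 0 <= linrec t 2 1 k by exact: luc_ge0.
  by rewrite !mulr_ge0 ?(ltW t_gt0) ?fib_ge0 ?L0 //; card_lia.
have cardW : #|W| = (#|C| + #|D|)%N by rewrite defW cardsU disjoint_setI0 // cards0 subn0.
have cardN : #|N :&: W| = (#|N :&: C| + #|N :&: D|)%N.
  rewrite defW setIUr cardsU setIACA setIid (disjoint_setI0 dCD) setI0.
  by rewrite cards0 subn0.
have eCD : dedges W = (dedges C + dedges D)%N by rewrite defW dedgesU.
have oC := odd_dedges C; have oD := odd_dedges D.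
(* All the terms are even, so failure in both parts would bound the total by [2 * #|W|]. *)
have [exC|exD] : (2 * #|C| + 2 <= dedges C + 2 * #|N :&: C|)%N \/
                 (2 * #|D| + 2 <= dedges D + 2 * #|N :&: D|)%N by card_lia.
  exact: (one C D).
apply: (one D C) => //; first by rewrite setUC.
  by rewrite disjoint_sym.
by move=> a b aD bC; rewrite adj_sym nCD.
Qed.

(** Deleting any vertex [v] and applying the ratio bound with N = N(v) gives L(n-1) I(P) <= L(n) I(P
    - v) = 0, against positivity. *)
Lemma unicyclic_not_all_pos : conn P -> #|P| = n -> (2 * n <= dedges P)%N -> False.
Proof.
move=> cP cardP eP.
have [v vP] := set0Pn _ cP.1.
have cP' := cardsD1 v P; rewrite vP in cP'.
have hv : L n.-2 * I (P :\ v) <= L n.-1 * I ((P :\ v) :\: nbh v).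
  have -> : n.-1 = #|P :\ v| by card_lia.
  apply: ipoly_double_hits; [exact: subsetDl | card_lia | exact: hits_nbh | ].
  have := dedges_rec vP.
  have -> : nbh v :&: (P :\ v) = nbh v :&: P.
    by apply/setP => w; rewrite !inE; case: eqP => [->|//]; rewrite adj_irrefl.
  card_lia.
have := conn_step (subxx P) vP _ hv.
have eL : L n.-1 - t * L n.-2 = L n.
  by move: n_gt2; case: (n) => [|[|m]].
rewrite eL Ln mul0r pmulr_rle0; last by apply: luc_gt0; card_lia.
move=> h; suff le0 : I P <= 0 by have := le_lt_trans le0 (I_gt0 (subxx P)); rewrite ltxx.
by apply: h; apply: luc_ge0; card_lia.
Qed.

End UpperBound.

(** * Graph stars *)

Section Starred.

Variables (G : sgraph) (P : {set G}) (pi : G -> G).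
Implicit Types (S Q A B C : {set G}).

(* G is the graph star of the subgraph induced by P, and pi p is the leaf
   attached to p. *)
Definition starred : Prop :=
  (forall p, p \in P -> pi p \notin P /\ nbh (pi p) = [set p]) /\
  P :|: pi @: P = setT.

Hypothesis starP : starred.

Lemma starred_inj : {in P &, injective pi}.
Proof.
move=> p q pP qP e; have [_ e1] := starP.1 p pP; have [_ e2] := starP.1 q qP.
by apply/set1P; rewrite -e2 -e e1 set11.
Qed.

Lemma starred_imsetD1 Q q : Q \subset P -> q \in Q ->
  pi @: (Q :\ q) = (pi @: Q) :\ pi q.
Proof.
move=> sQP qQ; apply/setP => y; rewrite in_setD1.
apply/imsetP/andP => [[x /setD1P[xq xQ] ->]|[yq /imsetP[x xQ e]]].
  split; last exact: imset_f.
  by apply: contra xq => /eqP/starred_inj-> //; apply: (subsetP sQP).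
exists x => //; rewrite !inE xQ andbT; apply: contra yq => /eqP <-.
by rewrite e.
Qed.

Lemma starred_disjoint S Q : S \subset P -> Q \subset P -> [disjoint S & pi @: Q].
Proof.
move=> sS sQ; rewrite disjoint_sym disjoints_subset; apply/subsetP => y /imsetP[x xQ ->].
rewrite inE; have [nP _] := starP.1 x (subsetP sQ x xQ).
by apply: contra nP; apply: (subsetP sS).
Qed.

Lemma starred_nbhI v Q : v \in P -> Q \subset P ->
  (pi @: Q) :\: nbh v = pi @: (Q :\ v).
Proof.
move=> vP sQ; have e q : q \in Q -> (pi q \in nbh v) = (q == v).
  move=> qQ; have [_ eq] := starP.1 q (subsetP sQ q qQ).
  by rewrite nbhC eq inE eq_sym.
apply/setP => y; rewrite inE; apply/andP/imsetP => [[yv /imsetP[q qQ ey]]|[q /setD1P[qv qQ] ->]].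
  by exists q => //; rewrite !inE qQ andbT -e // -ey.
by rewrite e // qv imset_f.
Qed.

(** Leaves are attached to a larger set [Q] because deleting a vertex of [S] alone leaves its leaf
    behind, isolated. Selecting [v] removes its leaf as well, which turns the weight [x] into x / (1
    + x). *)
Lemma ipoly_starred (R : fieldType) (x : R) S Q : 1 + x != 0 ->
    S \subset Q -> Q \subset P ->
  ipoly (S :|: pi @: Q) x = (1 + x) ^+ #|Q| * ipoly S (x / (1 + x)).
Proof.
move=> x1; have [n] := ubnP #|S|; elim: n S Q => // n IH S Q leS sSQ sQP.
have sSP := subset_trans sSQ sQP.
have [->|/set0Pn[v vS]] := eqVneq S set0.
  rewrite set0U ipoly0 mulr1 ipoly_edgeless.
    by rewrite card_in_imset // => p q /(subsetP sQP) pP /(subsetP sQP); apply: starred_inj.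
  apply/indepP => a b /imsetP[p pQ ->] /imsetP[q qQ ->].
  have [_ e] := starP.1 p (subsetP sQP p pQ); have [nP _] := starP.1 q (subsetP sQP q qQ).
  rewrite -in_nbh e inE; apply: contraNneq nP => ->.
  exact: (subsetP sQP).
have cS := cardsD1 v S; rewrite vS in cS.
have vP := subsetP sSP v vS; have vQ := subsetP sSQ v vS.
have sS1 : S :\ v \subset Q by apply: subset_trans sSQ; apply: subsetDl.
have vU : v \in S :|: pi @: Q by rewrite inE vS.
have e1 : (S :|: pi @: Q) :\ v = (S :\ v) :|: pi @: Q.
  rewrite setDUl; congr (_ :|: _); apply/setDidPl.
  by rewrite disjoint_sym starred_disjoint // sub1set.
have e2 : ((S :|: pi @: Q) :\ v) :\: nbh v
          = ((S :\ v) :\: nbh v) :|: pi @: (Q :\ v).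
  by rewrite e1 setDUl starred_nbhI.
rewrite (ipoly_rec _ vU) (ipoly_rec _ vS) e2 e1.
have leS2 : (#|(S :\ v) :\: nbh v| < n)%N.
  by have := subset_leq_card (subsetDl (S :\ v) (nbh v)); card_lia.
rewrite IH //; last by card_lia.
rewrite IH //; last 2 first.
- by apply: subset_trans (subsetDl _ _) _; apply: setSD.
- by apply: subset_trans sQP; apply: subsetDl.
have -> : #|Q| = #|Q :\ v|.+1 by rewrite (cardsD1 v Q) vQ.
rewrite exprS; field.
exact: x1.
Qed.

Lemma starred_card : #|G| = (2 * #|P|)%N.
Proof.
rewrite -cardsT -starP.2 cardsU disjoint_setI0 ?starred_disjoint // cards0 subn0.
rewrite card_in_imset; last exact: starred_inj.
by rewrite mul2n addnn.
Qed.

Lemma starred_dedges : dedges [set: G] = (dedges P + 2 * #|P|)%N.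
Proof.
rewrite -starP.2.
suff h Q : Q \subset P -> dedges (P :|: pi @: Q) = (dedges P + 2 * #|Q|)%N by exact: h.
have [n] := ubnP #|Q|; elim: n Q => // n IH Q leQ sQ.
have [->|/set0Pn[q qQ]] := eqVneq Q set0; first by rewrite imset0 setU0 cards0 addn0.
have cQ := cardsD1 q Q; rewrite qQ in cQ.
have qP := subsetP sQ q qQ; have [npi epi] := starP.1 q qP.
have vU : pi q \in P :|: pi @: Q by rewrite inE imset_f ?orbT.
have sQ' : Q :\ q \subset P by apply: subset_trans sQ; apply: subsetDl.
rewrite (dedges_rec vU) epi (setIidPl _) ?sub1set ?inE ?qP // cards1.
have -> : (P :|: pi @: Q) :\ pi q = P :|: pi @: (Q :\ q).
  rewrite setDUl starred_imsetD1 //; congr (_ :|: _); apply/setDidPl.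
  by rewrite disjoint_sym disjoints1.
rewrite IH //; card_lia.
Qed.

(** A set closed in [P], together with its leaves, is closed in [G]. *)
Lemma starred_conn : conn [set: G] -> conn P.
Proof.
move=> [nT cT]; split.
  apply: contraNneq nT => P0; rewrite -starP.2 P0 imset0 setU0 //.
move=> C sC C0 clC.
have eT : C :|: pi @: C = setT.
  apply: cT => //; first by apply: contraNneq C0; rewrite -!subset0 => <-; apply: subsetUl.
  move=> x y; rewrite !inE => /orP[xC|/imsetP[c cC ->]] _ xy.
    have : y \in P :|: pi @: P by rewrite starP.2.
    rewrite inE => /orP[yP|/imsetP[p pP ey]]; first by rewrite (clC x).
    have [_ epi] := starP.1 p pP.
    have : x \in nbh (pi p) by rewrite in_nbh adj_sym -ey.
    by rewrite epi => /set1P exp; rewrite ey -exp imset_f ?orbT.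
  have [_ epi] := starP.1 c (subsetP sC c cC).
  by move: xy; rewrite -in_nbh epi => /set1P->; rewrite cC.
apply/eqP; rewrite eqEsubset sC; apply/subsetP => p pP.
have : p \in C :|: pi @: C by rewrite eT.
rewrite inE => /orP[//|/imsetP[c cC e]].
by have [] := starP.1 c (subsetP sC c cC); rewrite -e pP.
Qed.

End Starred.

Section GraphStar.

Variable H : sgraph.

Definition star_leaf (v : graph_star H) : graph_star H :=
  match v with inl x => inr x | inr x => inr x end.

Definition star_base : {set graph_star H} := inl @: [set: H].

Lemma inl_base (S : {set H}) : (inl @: S : {set graph_star H}) \subset star_base.
Proof. exact: imsetS (subsetT S). Qed.

Lemma graph_starred : starred star_base star_leaf.
Proof.
split=> [p /imsetP[x _ ->] /=|].
  split; first by apply/negP => /imsetP[].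
  by apply/setP => -[y|y]; rewrite !inE //= eq_sym.
apply/setP => -[x|x]; rewrite !inE; first by rewrite imset_f ?inE.
by apply/orP; right; apply/imsetP; exists (inl x) => //; apply: imset_f; rewrite inE.
Qed.

Lemma card_star_base : #|star_base| = #|H|.
Proof. by rewrite card_imset ?cardsT // => x y []. Qed.

Lemma ipoly_inl (R : comPzRingType) (x : R) (S : {set H}) :
  ipoly (inl @: S : {set graph_star H}) x = ipoly S x.
Proof.
have inl_inj : injective (@inl H H) by move=> a b [].
have [n] := ubnP #|S|; elim: n S => // n IH S leS.
have [->|/set0Pn[v vS]] := eqVneq S set0; first by rewrite imset0 !ipoly0.
have cS := cardsD1 v S; rewrite vS in cS.
have vS' : inl v \in (inl @: S : {set graph_star H}) by rewrite imset_f.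
have memi (A : {set H}) (y : H) : (inl y \in (inl @: A : {set graph_star H})) = (y \in A).
  by rewrite mem_imset.
have memr (A : {set H}) (y : H) : (inr y \in (inl @: A : {set graph_star H})) = false.
  by apply/negbTE/negP => /imsetP[].
have e1 : (inl @: S : {set graph_star H}) :\ inl v = inl @: (S :\ v).
  by apply/setP => -[y|y]; rewrite in_setD1 ?memi ?memr ?andbF // !inE.
have e2 : (inl @: (S :\ v) : {set graph_star H}) :\: @nbh (graph_star H) (inl v)
          = inl @: ((S :\ v) :\: nbh v).
  by apply/setP => -[y|y]; rewrite in_setD ?memi ?memr ?andbF // !inE.
have leS2 : (#|(S :\ v) :\: nbh v| < n)%N.
  by have := subset_leq_card (subsetDl (S :\ v) (nbh v)); card_lia.
by rewrite (ipoly_rec _ vS') (ipoly_rec _ vS) e1 e2 !IH //; card_lia.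
Qed.

Lemma graph_star_conn : conn [set: H] -> conn [set: graph_star H].
Proof.
move=> [/set0Pn[x0 _] cH]; split; first by apply/set0Pn; exists (inl x0).
move=> C _ /set0Pn[v vC] clC.
have lr x : (inl x \in C) = (inr x \in C).
  by apply/idP/idP => h; apply: (clC _ _ h) => //=.
have e : [set x | inl x \in C] = setT.
  apply: cH => //.
    by case: v vC => x xC; apply/set0Pn; exists x; rewrite inE // lr.
  by move=> x y; rewrite !inE => xC _ xy; apply: (clC _ _ xC); rewrite ?inE.
have mem x : inl x \in C by have := in_setT x; rewrite -e inE.
by apply/setP => -[x|x]; rewrite inE ?mem // -lr mem.
Qed.

End GraphStar.

(** * Values for the extremal base graphs *)

Section CycleGraph.

Variables (n : nat) (R : comNzRingType) (t : R).
Hypothesis n_gt2 : (2 < n)%N.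

(** An arc that does not wrap around; it induces a path as long as it is not the whole cycle, whence
    the bound [k < n] later. *)
Definition seg a k : {set Cn n} := [set i : 'I_n | (a <= i < a + k)%N].

Lemma Cn_adjE (i j : Cn n) : adj i j =
  [|| j == i.+1 :> nat, i == j.+1 :> nat,
      (i == n.-1 :> nat) && (j == 0 :> nat) | (j == n.-1 :> nat) && (i == 0 :> nat)].
Proof.
have ltmod (k : 'I_n) : (k.+1 %% n = if k == n.-1 :> nat then 0 else k.+1)%N.
  have ltk := ltn_ord k; case: eqP => [->|ne].
    by rewrite prednK ?modnn //; lia.
  by rewrite modn_small //; lia.
rewrite /= /Cn_adj !ltmod -val_eqE /=.
have := ltn_ord i; have := ltn_ord j; move: (nat_of_ord i) (nat_of_ord j) n_gt2 => a b.
by case: (a =P n.-1); case: (b =P n.-1); clear; lia.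
Qed.

Lemma ipoly_seg a k : (a + k <= n)%N -> (k < n)%N ->
  ipoly (seg a k) (- t) = fib t k.+2.
Proof.
elim/ltn_ind: k => -[|[|k]] IH le lt.
- have -> : seg a 0 = set0 by apply/setP => i; rewrite !inE; lia.
  by rewrite ipoly0 /fib /= mulr0 subr0.
- have lta : (a < n)%N by lia.
  have e : seg a 1 = [set Ordinal lta].
    by apply/setP => i; rewrite !inE -val_eqE /=; lia.
  rewrite e (ipoly_rec _ (set11 _)) setDv set0D ipoly0 /fib /=; ring.
have ltv : (a + k.+1 < n)%N by lia.
pose v : Cn n := Ordinal ltv.
have vs : v \in seg a k.+2 by rewrite inE /=; lia.
have e1 : seg a k.+2 :\ v = seg a k.+1.
  by apply/setP => i; rewrite !inE -val_eqE /=; lia.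
have e2 : seg a k.+1 :\: nbh v = seg a k.
  apply/setP => i; rewrite !inE Cn_adjE /=; have := ltn_ord i; lia.
rewrite (ipoly_rec _ vs) e1 e2 !IH //; try lia.
rewrite mulNr [RHS]linrecSS //.
Qed.

Lemma ipoly_Cn : ipoly [set: Cn n] (- t) = luc t n.
Proof.
have ltv : (n.-1 < n)%N by lia.
pose v : Cn n := Ordinal ltv.
have e1 : setT :\ v = seg 0 n.-1.
  by apply/setP => i; rewrite !inE -val_eqE /=; have := ltn_ord i; lia.
have e2 : seg 0 n.-1 :\: nbh v = seg 1 (n - 3).
  apply/setP => i; rewrite !inE Cn_adjE /=; have := ltn_ord i; lia.
rewrite (ipoly_rec _ (in_setT v)) e1 e2 !ipoly_seg; try lia.
rewrite lucE; have -> : n = (n - 3).+3 by lia.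
rewrite !subSS subn0 /= /fib !linrecSS; ring.
Qed.

Lemma Cn_conn : conn [set: Cn n].
Proof.
have lt0 : (0 < n)%N by lia.
split; first by apply/set0Pn; exists (Ordinal lt0).
move=> C _ /set0Pn[i iC] clC.
have h k : Ordinal (ltn_pmod (i + k) lt0) \in C.
  elim: k => [|k IH].
    by rewrite (_ : Ordinal _ = i) //; apply/val_inj; rewrite /= addn0 modn_small.
  apply: (clC _ _ IH) => //=; rewrite /Cn_adj -val_eqE /=.
  have -> : ((i + k) %% n).+1 = ((i + k) %% n + 1)%N by rewrite addn1.
  rewrite modnDml -addnA addn1 eqxx /= andbT -addn1 addnA.
  rewrite -{1}[(i + k)%N]addn0 eqn_modDl mod0n modn_small //; lia.
apply/setP => j; rewrite inE.
suff <- : Ordinal (ltn_pmod (i + (n - i + j)) lt0) = j by exact: h.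
apply/val_inj => /=; have := ltn_ord i; have := ltn_ord j => lj li.
by rewrite addnA subnKC ?(ltnW li) // modnDl modn_small.
Qed.

End CycleGraph.

Section UnicyclicStarGraph.

Variables (n : nat) (n_gt2 : (2 < n)%N).

Lemma Un_conn : conn [set: Un n].
Proof.
have lt0 : (0 < n)%N by lia.
pose z : Un n := Ordinal lt0.
split; first by apply/set0Pn; exists z.
move=> C _ /set0Pn[i iC] clC.
have zC : z \in C.
  have [<- //|ne] := eqVneq i z.
  by apply: (clC i) => //=; rewrite /Un_adj ne /= !orbT.
apply/setP => j; rewrite inE.
have [-> //|ne] := eqVneq j z.
by apply: (clC z) => //=; rewrite /Un_adj eq_sym ne /= !orbT.
Qed.

(** The vertex 0 is adjacent to all others; without it an edge and n - 3 isolated vertices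
    remain. *)
Lemma ipoly_Un (R : comNzRingType) (t : R) :
  ipoly [set: Un n] (- t) = (1 - 2 * t) * (1 - t) ^+ (n - 3) - t.
Proof.
have lt0 : (0 < n)%N by lia.
have lt1 : (1 < n)%N by lia.
pose z : Un n := Ordinal lt0; pose a : Un n := Ordinal lt1; pose b : Un n := Ordinal n_gt2.
pose D : {set Un n} := [set i : 'I_n | (2 < i)%N].
have ab : adj a b by [].
have eD : setT :\ z = [set a; b] :|: D.
  by apply/setP => i; rewrite !inE -!val_eqE /=; lia.
have e0 : (setT :\ z) :\: nbh z = set0.
  apply/setP => i; rewrite !inE /= /Un_adj -!val_eqE /=; lia.
rewrite (ipoly_rec _ (in_setT z)) e0 eD ipoly0 mulr1; congr (_ + _).
rewrite ipolyU; last 2 first.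
- rewrite disjoint_sym disjoints_subset; apply/subsetP => i.
  by rewrite !inE -!val_eqE /=; lia.
- move=> i j; rewrite !inE /= /Un_adj -!val_eqE /=; lia.
congr (_ * _).
  rewrite (ipoly_rec _ (set21 a b)).
  have -> : [set a; b] :\ a = [set b] by rewrite setU1K // inE adj_neq.
  have -> : [set b] :\: nbh a = set0 by apply/eqP; rewrite setD_eq0 sub1set inE.
  rewrite (ipoly_rec _ (set11 b)) setDv set0D !ipoly0; ring.
rewrite ipoly_edgeless; last first.
  apply/indepP => i j; rewrite !inE /= /Un_adj; lia.
congr (_ ^+ _).
have cT := cardsT (Un n); rewrite card_ord in cT.
have cz := cardsD1 z (setT : {set Un n}); rewrite eD inE cT cardsU cards2 adj_neq // in cz.
rewrite disjoint_setI0 in cz.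
  by rewrite cards0 in cz; lia.
rewrite disjoint_sym disjoints_subset; apply/subsetP => i.
by rewrite !inE -!val_eqE /=; lia.
Qed.

End UnicyclicStarGraph.

(** * Comparing first zeros through the base graphs *)

Section StarredBounds.

Section Transfer.

Variables (G : sgraph) (P : {set G}) (pi : G -> G) (s : algR).
Hypothesis starP : starred P pi.
Hypothesis s_lt1 : s < 1.

Lemma ipoly_starred_sub (S : {set G}) : S \subset P ->
  ipoly (S :|: pi @: S) (- s) = (1 - s) ^+ #|S| * ipoly S (- (s / (1 - s))).
Proof.
move=> sS; rewrite (ipoly_starred starP) ?mulNr //.
by rewrite subr_eq0 eq_sym lt_eqF.
Qed.

Lemma ipoly_starred_gt0 (S : {set G}) : S \subset P ->
  (0 < ipoly (S :|: pi @: S) (- s)) = (0 < ipoly S (- (s / (1 - s)))).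
Proof.
by move=> sS; rewrite ipoly_starred_sub // pmulr_rgt0 // exprn_gt0 // subr_gt0.
Qed.

Lemma ipoly_starred_eq0 :
  (ipoly [set: G] (- s) == 0) = (ipoly P (- (s / (1 - s))) == 0).
Proof.
have := ipoly_starred_sub (subxx P); rewrite starP.2 => ->.
by rewrite mulf_eq0 expf_eq0 subr_eq0 [1 == s]eq_sym lt_eqF // andbF.
Qed.

Lemma starred_neqT (S : {set G}) : S \subset P -> S != P -> S :|: pi @: S != setT.
Proof.
move=> sS; apply: contraNneq => eT; rewrite eqEsubset sS; apply/subsetP => p pP.
have : p \in S :|: pi @: S by rewrite eT.
rewrite inE => /orP[//|pS].
have := starred_disjoint starP (subxx P) sS.
by move=> /disjointFr/(_ pP); rewrite pS.
Qed.

End Transfer.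

Variables (n : nat) (G : sgraph) (P : {set G}) (pi : G -> G).
Hypothesis n_gt2 : (2 < n)%N.
Hypothesis starP : starred P pi.
Hypothesis connG : conn [set: G].
Hypothesis dedgesG : dedges [set: G] = (2 * #|G|)%N.
Hypothesis cardP : #|P| = n.

Lemma starred_bounds :
  xi (graph_star (Cn n)) <= xi G <= xi (graph_star (Un n)).
Proof.
have connP := starred_conn starP connG.
have dedgesP : dedges P = (2 * #|P|)%N.
  have := starred_dedges starP; have := starred_card starP; rewrite dedgesG; lia.
have [tG [tG0 rG posG posG' ->]] := first_root connG.
have [tC [tC0 rC posC posC' ->]] := first_root (graph_star_conn (Cn_conn n_gt2)).
have [tU [tU0 rU posU posU' ->]] := first_root (graph_star_conn (Un_conn n_gt2)).
(* A single vertex is a proper subset with value 1 - t, so the change of variable t / (1 - t) is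
   legitimate. *)
have lt1 (K : sgraph) (t : algR) : (1 < #|K|)%N ->
    (forall S : {set K}, S != setT -> 0 < ipoly S (- t)) -> t < 1.
  move=> K1 pos; have [v _] : exists v, v \in [set: K].
    by apply/set0Pn; rewrite -card_gt0 cardsT; lia.
  rewrite -subr_gt0 -(ipoly_set1 t v); apply: pos.
  by apply: contraTneq K1 => e; rewrite -cardsT -e cards1.
have tG1 : tG < 1 by apply: lt1 posG; rewrite (starred_card starP); lia.
have starC := graph_starred (Cn n); have starU := graph_starred (Un n).
have tC1 : tC < 1.
  apply: lt1 posC; rewrite (starred_card starC) card_star_base card_ord; lia.
rewrite !lerN2; apply/andP; split.
  suff : tG <= tC by [].
  (* If the cycle vanished earlier, the subsets of [P] would all be positive at a zero of [luc n],
     as [unicyclic_not_all_pos] forbids. *)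
  rewrite leNgt; apply/negP => ltCG.
  have tCG : 0 <= tC < tG by rewrite (ltW tC0).
  pose t := tC / (1 - tC).
  have t0 : 0 < t by rewrite divr_gt0 // subr_gt0.
  apply: (@unicyclic_not_all_pos G algR t n P) => //.
  - by move=> S sS; rewrite -(ipoly_starred_gt0 starP) // posG'.
  - move=> [|[|k]] //= lek.
    have ltk : (k < n)%N by lia.
    have lt0 : (n.-1 < n)%N by lia.
    rewrite -(ipoly_seg _ n_gt2 (a := 0)) ?add0n ?(ltnW ltk) //.
    rewrite -ipoly_inl -(ipoly_starred_gt0 starC) ?inl_base //; apply: posC.
    apply: (starred_neqT starC); first exact: inl_base.
    apply/eqP => /setP/(_ (inl (Ordinal lt0))).
    rewrite mem_imset; last by move=> a b [].
    rewrite inE /= mem_imset; last by move=> a b [].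
    by rewrite inE => /idP; lia.
  - have := ipoly_starred_eq0 starC tC1; rewrite rC eqxx.
    by rewrite ipoly_inl (ipoly_Cn _ n_gt2) => /esym/eqP.
  - by rewrite dedgesP cardP.
suff : tU <= tG by [].
(* If [G] vanished earlier, the value for [Un] would be positive there, yet at most I(P) = 0. *)
rewrite leNgt; apply/negP => ltGU.
pose t := tG / (1 - tG).
have t0 : 0 < t by rewrite divr_gt0 // subr_gt0.
have I0 : ipoly P (- t) = 0.
  by have := ipoly_starred_eq0 starP tG1; rewrite rG eqxx => /esym/eqP.
have := ipoly_unicyclic_ge (ltW t0) _ (subxx P) connP dedgesP.
rewrite I0 cardP -(ipoly_Un n_gt2) -ipoly_inl.
have := posU' tG setT; rewrite (ltW tG0) ltGU => /(_ isT).
have <- : star_base (Un n) :|: @star_leaf (Un n) @: star_base (Un n) = setT.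
  exact: starU.2.
rewrite (ipoly_starred_gt0 starU) // => h1 h2.
suff I_ge0 (S : {set G}) : S \subset P -> 0 <= ipoly S (- t).
  by have := lt_le_trans h1 (h2 I_ge0); rewrite ltxx.
move=> sS.
have [->|nS] := eqVneq S P; first by rewrite I0.
apply: ltW; rewrite -(ipoly_starred_gt0 starP tG1) // posG //.
exact: (starred_neqT starP sS nS).
Qed.

End StarredBounds.

(** * Cycles and edge counts *)

Section Cycles.

Variable G : sgraph.
Implicit Types (c : seq G) (S T X Z : {set G}).

Definition gcycle c := (2 < size c)%N && ucycleb (@adj G) c.

Lemma gcycleP c : reflect ((2 < size c)%N /\ ucycle (@adj G) c) (gcycle c).
Proof. exact: andP. Qed.

(** Deleting a vertex of degree at most 1 keeps at least as many edges as vertices; the process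
    cannot empty the set, since one vertex spans no edge. *)
Lemma min_degree2 S : S != set0 -> (2 * #|S| <= dedges S)%N ->
  exists2 T : {set G}, T != set0 & forall v, v \in T -> (1 < #|nbh v :&: T|)%N.
Proof.
have [n] := ubnP #|S|; elim: n S => // n IH S leS S0 eS.
have [/forall_inP h|] := boolP [forall v in S, (1 < #|nbh v :&: S|)%N].
  by exists S.
rewrite negb_forall_in => /exists_inP[v vS]; rewrite -leqNgt => dv.
have cS := cardsD1 v S; rewrite vS in cS.
have eD := dedges_rec vS.
apply: (IH (S :\ v)); [card_lia | | card_lia].
rewrite -card_gt0 lt0n; apply/eqP => e0.
by have := dedges_leq S; move: eS; rewrite cS e0; card_lia.
Qed.

(** A path in [T] is prolonged at its head, avoiding the vertex just visited, until it meets itself;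
    paths have bounded length. *)
Lemma gcycle_exists T : T != set0 ->
    (forall v, v \in T -> (1 < #|nbh v :&: T|)%N) ->
  exists c, gcycle c.
Proof.
move=> /set0Pn[x0 x0T] dT.
have h k : (exists c, gcycle c) \/
    exists x p, [/\ path (@adj G) x p, uniq (x :: p), {subset x :: p <= T} & size p = k].
  elim: k => [|k [|[x [p [pp up sp <-]]]]]; [right | by left | ].
    by exists x0, [::]; split => // y; rewrite inE => /eqP->.
  have xT : x \in T by rewrite sp ?mem_head.
  (* For an empty [p] the default is [x], which is not its own neighbour, so nothing is excluded. *)
  have [y] : exists y, y \in (nbh x :&: T) :\ head x p.
    apply/set0Pn; rewrite -card_gt0.
    have := cardsD1 (head x p) (nbh x :&: T); have := dT x xT.
    by case: (_ \in _); lia.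
  rewrite !inE => /and3P[yh xy yT].
  have [yxp|yxp] := boolP (y \in x :: p); last first.
    right; exists y, (x :: p); split => //=.
    - by rewrite adj_sym xy.
    - by rewrite yxp.
    - by move=> z; rewrite inE => /predU1P[->//|]; apply: sp.
  left; move: yxp; rewrite inE eq_sym (negbTE (adj_neq xy)) /= => yp.
  case/splitPr: yp yh pp up {sp} => p1 p2 yh.
  rewrite cat_path /= => /and3P[pp1 lp1 _] up.
  exists (x :: rcons p1 y); apply/gcycleP; split.
    by rewrite /= size_rcons; case: p1 yh {pp1 lp1 up} => //=; rewrite eqxx.
  apply/andP; split.
    by rewrite /= !rcons_path pp1 lp1 last_rcons adj_sym xy.
  move: up; rewrite -cat_rcons mem_cat negb_or cat_uniq.
  by move=> /andP[/andP[xp _] /and3P[up _ _]]; rewrite /= xp.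
have [//|[x [p [_ up _ sp]]]] := h #|G|.
by have := max_card (mem (x :: p)); rewrite (card_uniqP up) /= sp ltnn.
Qed.

Lemma gcycle_rot i c : gcycle (rot i c) = gcycle c.
Proof. by rewrite /gcycle size_rot /ucycleb rot_cycle rot_uniq. Qed.

Lemma gcycle_nbrs c x : gcycle c -> x \in c ->
  exists y z, [/\ y != z, y \in c, z \in c, adj x y & adj x z].
Proof.
move=> gc /rot_to[i p e]; move: gc; rewrite -(gcycle_rot i) e => gc.
have memc y : (y \in c) = (y \in x :: p) by rewrite -e mem_rot.
have {gc} /gcycleP[] := gc.
case: p memc {e} => [|y [|z q]] memc //= _ /andP[/=].
rewrite rcons_path => /and4P[xy _ _ lx].
rewrite !inE !negb_or => /and3P[_ /andP[yz yq] _].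
exists y, (last z q); rewrite !memc; split.
- apply: contraNneq yq => e; have := mem_last z q; rewrite -e inE => /predU1P[ezy|//].
  by rewrite ezy eqxx in yz.
- by rewrite !inE eqxx orbT.
- by rewrite in_cons in_cons mem_last !orbT.
- by [].
- by rewrite adj_sym.
Qed.

Lemma dedges_gcycle c : gcycle c ->
  (2 * #|[set x in c]| <= dedges [set x in c])%N.
Proof.
move=> gc; rewrite mulnC -sum_nat_const; apply: leq_sum => x; rewrite inE => xc.
have [y [z [yz yc zc xy xz]]] := gcycle_nbrs gc xc.
apply: (@leq_trans #|[set y; z]|); first by rewrite cards2 yz.
by apply: subset_leq_card; rewrite subUset !sub1set !inE xy xz yc zc.
Qed.

(** Each vertex attached to [Z] brings an edge with it, so the excess of edges over vertices does
    not decrease. *)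
Lemma dedges_grow Z : conn [set: G] -> Z != set0 ->
  (dedges Z + 2 * #|G| <= dedges [set: G] + 2 * #|Z|)%N.
Proof.
move=> cG; have [n] := ubnP #|~: Z|; elim: n Z => // n IH Z leZ Z0.
have [->|ZT] := eqVneq Z setT; first by rewrite cardsT.
have [x [y [xZ _ yZ xy]]] := conn_adj_out cG (subsetT Z) Z0 ZT.
have cZ := cardsC Z; have cyZ := cardsU1 y Z; rewrite yZ in cyZ.
have cZ' := cardsC (y |: Z).
have h : (dedges (y |: Z) + 2 * #|G| <= dedges [set: G] + 2 * #|y |: Z|)%N.
  by apply: IH; [lia | apply/set0Pn; exists y; rewrite setU11].
have d0 : (0 < #|nbh y :&: (y |: Z)|)%N.
  by rewrite card_gt0; apply/set0Pn; exists x; rewrite !inE adj_sym xy xZ orbT.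
have := dedges_rec (setU11 y Z); rewrite setU1K //; lia.
Qed.

(** [Z] already carries all the cycles the edge count allows. Degrees at least 2 in [X] use up the
    remaining edges, so none joins [X] to [Z], and connectivity makes [X] empty. *)
Lemma no_outside X Z : conn [set: G] -> (dedges [set: G] <= 2 * #|G|)%N ->
    Z != set0 -> (2 * #|Z| <= dedges Z)%N -> [disjoint X & Z] ->
    (forall x, x \in X -> (1 < #|nbh x|)%N /\ nbh x \subset X :|: Z) ->
  X = set0.
Proof.
move=> cG eG Z0 eZ dXZ hX.
have UZ0 : X :|: Z != set0 by apply: contraNneq Z0; rewrite -!subset0 => <-; apply: subsetUr.
have := dedges_grow cG UZ0.
have cXZ : #|X :|: Z| = (#|X| + #|Z|)%N by rewrite cardsU disjoint_setI0 // cards0 subn0.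
have e : dedges (X :|: Z)
    = (\sum_(x in X) #|nbh x| + dedges Z + \sum_(z in Z) #|nbh z :&: X|)%N.
  rewrite /dedges (eq_bigl [in [predU X & Z]]) => [|i]; last by rewrite !inE.
  rewrite bigU //= -addnA -big_split /=; congr (_ + _)%N; apply: eq_bigr => x xX.
    by rewrite (setIidPl _) //; have [] := hX x xX.
  rewrite setIUr cardsU setIACA setIid (disjoint_setI0 dXZ) setI0 cards0 subn0.
  by rewrite addnC.
have leX : (2 * #|X| <= \sum_(x in X) #|nbh x|)%N.
  by rewrite mulnC -sum_nat_const; apply: leq_sum => x /hX[].
move=> grow; have /eqP : (\sum_(z in Z) #|nbh z :&: X| = 0)%N by lia.
rewrite sum_nat_eq0 => /forall_inP noZX.
have clX : closed_in setT X.
  move=> x y xX _ xy; have [_ /subsetP/(_ y)] := hX x xX.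
  rewrite !inE => /(_ xy) /orP[//|yZ].
  have := noZX y yZ; rewrite cards_eq0 => /eqP/setP/(_ x).
  by rewrite !inE adj_sym xy xX.
have [//|X0] := eqVneq X set0.
have eX := cG.2 X (subsetT _) X0 clX.
by move: Z0 dXZ; rewrite eX -setI_eq0 setTI => /negbTE->.
Qed.

End Cycles.

(** * From the unique cycle to the edge count *)

Section DeleteEdge.

Variables (G : sgraph) (a b : G).

Definition is_pair (a b x y : G) := (x == a) && (y == b) || (x == b) && (y == a).

Lemma is_pair_sym a' b' x y : is_pair a' b' x y = is_pair a' b' y x.
Proof. by rewrite /is_pair andbC [_ && (y == a')]andbC orbC. Qed.

Definition del_adj : rel G := fun x y => adj x y && ~~ is_pair a b x y.

Fact del_adj_sym : symmetric del_adj.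
Proof. by move=> x y; rewrite /del_adj adj_sym is_pair_sym. Qed.

Fact del_adj_irrefl : irreflexive del_adj.
Proof. by move=> x; rewrite /del_adj adj_irrefl. Qed.

Definition del_edge : sgraph := SGraph del_adj_sym del_adj_irrefl.

Lemma dedges_del : adj a b ->
  (dedges [set: G] = dedges [set: del_edge] + 2)%N.
Proof.
move=> ab; have neab := adj_neq ab; rewrite /dedges.
have nT (H : sgraph) (v : H) : #|nbh v :&: setT| = #|nbh v| by rewrite setIT.
rewrite (eq_bigr _ (fun v _ => nT G v)) (eq_bigr _ (fun v _ => nT del_edge v)).
rewrite (bigD1 a) ?inE //= (bigD1 b) ?inE //= 1?eq_sym //.
rewrite [in RHS](bigD1 a) ?inE //= [in RHS](bigD1 b) ?inE //= 1?eq_sym //.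
rewrite (cardsD1 b (nbh a)) (cardsD1 a (nbh b)) !inE ab adj_sym ab.
have -> : @nbh del_edge a = nbh a :\ b.
  apply/setP => y; rewrite !inE /= /del_adj /is_pair eqxx (negbTE neab) /= orbF.
  by rewrite andbC.
have -> : @nbh del_edge b = nbh b :\ a.
  apply/setP => y; rewrite !inE /= /del_adj /is_pair eqxx.
  by rewrite [b == a]eq_sym (negbTE neab) /= andbC.
set X := (\sum_(i | _) _)%N; set Y := (X in _ = (_ + (_ + X) + _)%N).
suff -> : X = Y by lia.
apply: eq_big => [v|v /andP[/andP[_ va] vb]]; first by rewrite !inE.
apply: eq_card => y; rewrite !inE /= /del_adj /is_pair.
by rewrite (negbTE va) (negbTE vb) andbT.
Qed.

End DeleteEdge.

Section Unicyclic.

Variable G : sgraph.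
Hypothesis connG : conn [set: G].
Hypothesis uniG : unicyclic G.

Lemma gcycle_is_cycle (c : seq G) : gcycle c -> is_cycle (cycle_edges c).
Proof. by move=> /gcycleP[sc uc]; exists c. Qed.

Lemma unicyclic_edges (c c' : seq G) : gcycle c -> gcycle c' ->
  cycle_edges c = cycle_edges c'.
Proof.
have [E [_ uE]] := uniG.
by move=> /gcycle_is_cycle/uE <- /gcycle_is_cycle/uE.
Qed.

Lemma mem_cycle_edges (c : seq G) x : gcycle c ->
  (x \in cover (cycle_edges c)) = (x \in c).
Proof.
move=> gc; apply/bigcupP/idP => [[E /imsetP[y yc ->]]|xc].
  by rewrite !inE => /orP[]/eqP->; rewrite ?mem_next.
by exists [set x; next c x]; [apply: imset_f | rewrite set21].
Qed.

Lemma unicyclic_vertices (c c' : seq G) : gcycle c -> gcycle c' -> c =i c'.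
Proof.
move=> gc gc' x; rewrite -(mem_cycle_edges x gc) -(mem_cycle_edges x gc').
by rewrite (unicyclic_edges gc gc').
Qed.

Lemma unicyclic_gcycle : exists c : seq G, gcycle c.
Proof. by have [E [[c [sc uc _]] _]] := uniG; exists c; apply/gcycleP. Qed.

(** With more edges, deleting an edge of the cycle would leave enough of them for a cycle that
    avoids this edge, a second cycle of [G]. *)
Lemma unicyclic_dedges : dedges [set: G] = (2 * #|G|)%N.
Proof.
have [c gc] := unicyclic_gcycle.
apply/eqP; rewrite eqn_leq andbC; apply/andP; split.
  have Z0 : [set x in c] != set0.
    have /gcycleP[sc _] := gc; case: (c) sc => [|x p] // _.
    by apply/set0Pn; exists x; rewrite inE mem_head.
  have := dedges_grow connG Z0; have := dedges_gcycle gc; lia.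
rewrite leqNgt; apply/negP => lt.
have [x xc] : exists x, x \in c.
  by have /gcycleP[sc _] := gc; case: (c) sc => [|x p] // _; exists x; rewrite mem_head.
pose y := next c x.
have /gcycleP[_ /andP[cc _]] := gc.
have xy : adj x y by apply: next_cycle.
pose G' := del_edge x y.
have eG := dedges_del xy; have oG := odd_dedges [set: G].
have [||T T0 dT] := @min_degree2 G' setT.
- by apply/set0Pn; exists x.
- rewrite cardsT (_ : #|G'| = #|G|) //.
  by move: eG oG lt; rewrite -/G'; move: (dedges _) (dedges _) #|G|; clear; lia.
- have [c' /gcycleP[sc' /andP[cc' uc']]] := gcycle_exists T0 dT.
  have gc' : @gcycle G c'.
    apply/gcycleP; split => //; apply/andP; split => //.
    by apply: sub_cycle cc' => u v /andP[].
  have : [set x; y] \in @cycle_edges G c'.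
    rewrite -(unicyclic_edges gc gc').
    exact: (imset_f (fun x => [set x; next c x])) xc.
  case/imsetP => z zc' e.
  have := next_cycle cc' zc'; rewrite /= /del_adj => /andP[adjz].
  have := adj_neq adjz; have := set21 z (next c' z); have := set22 z (next c' z).
  rewrite -e /is_pair !inE.
  by do 2![case/orP=> /eqP->]; rewrite ?eqxx ?orbT.
Qed.

End Unicyclic.

(** * Well-covered unicyclic graphs of even order *)

Section ShortCycles.

Variable G : sgraph.

Lemma gcycle3 (a b c : G) : adj a b -> adj b c -> adj c a -> gcycle [:: a; b; c].
Proof.
move=> ab bc ca; have := adj_neq ab; have := adj_neq bc; have := adj_neq ca.
move=> nca nbc nab; rewrite /gcycle /ucycleb /= ab bc ca !inE !negb_or.
by rewrite nab nbc eq_sym nca.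
Qed.

Lemma gcycle4 (a b c d : G) : adj a b -> adj b c -> adj c d -> adj d a ->
  a != c -> b != d -> gcycle [:: a; b; c; d].
Proof.
move=> ab bc cd da nac nbd.
have := adj_neq ab; have := adj_neq bc; have := adj_neq cd; have := adj_neq da.
move=> nda ncd nbc nab; rewrite /gcycle /ucycleb /= ab bc cd da !inE !negb_or.
by rewrite nab nac nbc nbd ncd eq_sym nda.
Qed.

Lemma gcycle5 (a b c d e : G) :
    adj a b -> adj b c -> adj c d -> adj d e -> adj e a ->
    a != c -> a != d -> b != d -> b != e -> c != e ->
  gcycle [:: a; b; c; d; e].
Proof.
move=> ab bc cd de ea nac nad nbd nbe nce.
have := adj_neq ab; have := adj_neq bc; have := adj_neq cd; have := adj_neq de.
have := adj_neq ea.
move=> nea nde ncd nbc nab; rewrite /gcycle /ucycleb /= ab bc cd de ea !inE !negb_or.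
by rewrite nab nac nad nbc nbd nbe ncd nce nde eq_sym nea.
Qed.

Lemma gcycle_boundary (a : pred G) (c : seq G) : gcycle c ->
    has a c -> ~~ all a c ->
  exists s x q, [/\ gcycle (s :: x :: q), size c = (size q).+2,
                    c =i s :: x :: q, ~~ a s & a x].
Proof.
move=> gc ac; rewrite -has_predC => /hasP[s0 s0c /= as0].
have [i p e] := rot_to s0c.
have ap : has a p.
  by move: ac; rewrite -(has_rot i) e /= (negbTE as0).
have [p1 [s [x [p2 [e2 aS ax]]]]] :
    exists p1 s x p2, [/\ s0 :: p = p1 ++ s :: x :: p2, ~~ a s & a x].
  elim: p s0 as0 ap {s0c e} => // y p IH s0 as0 /=.
  have [ay _|ay /= ap] := boolP (a y); first by exists [::], s0, y, p.
  by have [p1 [s [x [p2 [-> aS ax]]]]] := IH y ay ap; exists (s0 :: p1), s, x, p2.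
have e3 : rot (size p1) (rot i c) = s :: x :: (p2 ++ p1).
  by rewrite e e2 rot_size_cat.
exists s, x, (p2 ++ p1); rewrite -e3 !gcycle_rot; split => //.
  by rewrite -(size_rot i) -(size_rot (size p1)) e3.
by move=> y; rewrite !mem_rot.
Qed.

End ShortCycles.

(** * Leaves, supports and inner vertices *)

Section WellCovered.

Variable G : sgraph.
Hypothesis wcG : well_covered G.
Implicit Types (A B W : {set G}) (s l v x y : G).

Lemma extend_indep A : independent A ->
  exists2 B, maxset (@independent G) B & A \subset B.
Proof. by move=> iA; have [B mB sAB] := maxset_exists iA; exists B. Qed.

Lemma wc_leq A B : maxset (@independent G) B -> independent A -> (#|A| <= #|B|)%N.
Proof.
move=> mB /extend_indep[C mC sAC]; rewrite (wcG mB mC).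
exact: subset_leq_card.
Qed.

(** Replacing [b] by [a] and [c] would give an independent set larger than a maximal one. *)
Lemma wc_exchange B (a b c : G) : maxset (@independent G) B -> b \in B ->
    a \notin B -> c \notin B -> a != c -> ~~ adj a c ->
    {in B, forall y, adj a y -> y = b} -> {in B, forall y, adj c y -> y = b} ->
  False.
Proof.
move=> mB bB aB cB nac adjac ha hc.
have /indepP iB := maxsetp mB.
have dj v : {in B, forall y, adj v y -> y = b} -> [disjoint B :\ b & nbh v].
  move=> hv; apply/pred0P => y /=; apply/negP => /andP[/setD1P[yb yB]].
  by rewrite inE => /(hv y yB) e; rewrite e eqxx in yb.
have i1 : independent (c |: (B :\ b)).
  rewrite indepU1 ?in_setD1 ?(negbTE cB) ?andbF // dj // andbT.
  by apply/indepP => x y /setD1P[_ xB] /setD1P[_ yB]; apply: iB.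
have aN : a \notin c |: (B :\ b) by rewrite !inE negb_or nac (negbTE aB) andbF.
have i2 : independent (a |: (c |: (B :\ b))).
  rewrite indepU1 // i1 /=; apply/pred0P => y /=; apply/negP => /andP[/setU1P[->|yB]].
    by rewrite inE (negbTE adjac).
  by move/(disjointFr (dj a ha)): yB => ->.
have := wc_leq mB i2; rewrite !cardsU1 aN !inE (negbTE cB) andbF /=.
by rewrite (cardsD1 b B) bB; lia.
Qed.

Hypothesis connG : conn [set: G].
Hypothesis G_gt2 : (2 < #|G|)%N.

Definition leaves : {set G} := [set v : G | #|nbh v| == 1%N].
Definition supports : {set G} := [set v : G | [exists l in leaves, adj v l]].
Definition inner : {set G} := ~: (leaves :|: supports).
Definition leaf_of (s : G) : G := odflt s [pick l in leaves | adj s l].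

Lemma nbh_gt0 v : (0 < #|nbh v|)%N.
Proof.
rewrite card_gt0; apply/negP => /eqP e.
have /(congr1 (fun A : {set G} => #|A|)) : [set v] = setT.
  apply: connG.2; rewrite ?subsetT //; first by apply/set0Pn; exists v; rewrite set11.
  by move=> x y /set1P-> _; rewrite -in_nbh e in_set0.
by rewrite cards1 cardsT; lia.
Qed.

Lemma nbh_gt1 v : v \notin leaves -> (1 < #|nbh v|)%N.
Proof. by rewrite inE; have := nbh_gt0 v; lia. Qed.

Lemma leaf_nbh l s : l \in leaves -> adj l s -> nbh l = [set s].
Proof.
rewrite inE => /cards1P[x e] ls; rewrite e.
by have : s \in nbh l; [rewrite inE | rewrite e => /set1P->].
Qed.

Lemma leaf_ofP s : s \in supports -> leaf_of s \in leaves /\ adj s (leaf_of s).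
Proof.
rewrite inE /leaf_of => /exists_inP[l lL sl].
by case: pickP => [l' /andP[]|/(_ l)]; rewrite ?lL ?sl.
Qed.

Lemma nbh_leaf_of s : s \in supports -> nbh (leaf_of s) = [set s].
Proof. by case/leaf_ofP => lL sl; apply: leaf_nbh; rewrite // adj_sym. Qed.

(** Two adjacent leaves would be a whole component, hence all of [G]. *)
Lemma leaf_not_support v : v \in leaves -> v \notin supports.
Proof.
move=> vL; apply/negP; rewrite inE => /exists_inP[l lL vl].
have ev := leaf_nbh vL vl; have el : nbh l = [set v] by apply: leaf_nbh; rewrite // adj_sym.
have /(congr1 (fun A : {set G} => #|A|)) : [set v; l] = setT.
  apply: connG.2; rewrite ?subsetT //; first by apply/set0Pn; exists v; rewrite set21.
  by move=> x y /set2P[]-> _; rewrite -in_nbh ?ev ?el => /set1P->; rewrite !inE eqxx ?orbT.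
by rewrite cardsT cards2; case: (_ == _); lia.
Qed.

Lemma adj_leaf_support l s : l \in leaves -> adj s l -> s \in supports.
Proof. by move=> lL sl; rewrite inE; apply/exists_inP; exists l. Qed.

(** Two leaves at [s] could be exchanged for [s]. Leaves and supports are therefore in bijection,
    and the number of inner vertices has the parity of the order. *)
Lemma leaf_uniq s l l' : l \in leaves -> l' \in leaves -> adj s l -> adj s l' ->
  l = l'.
Proof.
move=> lL l'L sl sl'; apply/eqP; apply: contraT => ne.
have i1 : independent [set s].
  by apply/indepP => x y /set1P-> /set1P->; rewrite adj_irrefl.
have [B mB] := extend_indep i1; rewrite sub1set => sB.
have /indepP iB := maxsetp mB.
have notin v : adj s v -> v \notin B.
  by move=> sv; apply/negP => vB; have := iB s v sB vB; rewrite sv.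
have hl v : v \in leaves -> adj s v -> {in B, forall y, adj v y -> y = s}.
  move=> vL sv y _; rewrite -in_nbh (leaf_nbh vL (_ : adj v s)) 1?adj_sym //.
  by move/set1P.
case: (wc_exchange mB sB (notin l sl) (notin l' sl') ne); rewrite ?hl //.
- rewrite -in_nbh (leaf_nbh lL (_ : adj l s)) 1?adj_sym // inE.
  by apply: contraTneq sl' => ->; rewrite adj_irrefl.
- exact: hl.
- exact: hl.
Qed.

Lemma leaf_of_img : leaf_of @: supports = leaves.
Proof.
apply/setP => l; apply/imsetP/idP => [[s /leaf_ofP[lL _] -> //]|lL].
have /card_gt0P[s] := nbh_gt0 l; rewrite in_nbh adj_sym => sl.
have sS : s \in supports by apply: adj_leaf_support sl.
exists s => //; have [l'L sl'] := leaf_ofP sS; exact: leaf_uniq sl sl'.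
Qed.

Lemma card_leaves : #|leaves| = #|supports|.
Proof.
rewrite -leaf_of_img card_in_imset // => a b aS bS e.
by apply/set1P; rewrite -(nbh_leaf_of bS) -e nbh_leaf_of // set11.
Qed.

Lemma card_inner : #|G| = (2 * #|supports| + #|inner|)%N.
Proof.
rewrite /inner -(cardsC (leaves :|: supports)) cardsU disjoint_setI0.
  by rewrite cards0 subn0 card_leaves; lia.
rewrite disjoints_subset; apply/subsetP => v /leaf_not_support.
by rewrite in_setC.
Qed.

Lemma innerP x : reflect (x \notin leaves /\ x \notin supports) (x \in inner).
Proof. by rewrite in_setC in_setU negb_or; apply: andP. Qed.

Lemma nbr_inner x y : x \in inner -> adj x y -> y \notin leaves.
Proof.
move=> /innerP[_ xS] xy; apply: contra xS => yL; exact: adj_leaf_support xy.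
Qed.

Lemma not_leafP v : (v \notin leaves) = (v \in supports) || (v \in inner).
Proof.
rewrite in_setC in_setU negb_or; case: (boolP (v \in supports)) => [vS|_].
  by rewrite /=; apply/negP => /leaf_not_support; rewrite vS.
by rewrite /= andbT.
Qed.

(* Let s be a support. If an independent set W outside N[s] and N[x]
   dominated the inner neighbours of x, then a maximal independent set
   containing s, W and the leaves of the other supports adjacent to x would
   become larger by exchanging s for x and the leaf of s. *)
Lemma no_dominating s x W : s \in supports -> x \in inner -> adj s x ->
    independent W ->
    {in W, forall w, [/\ w != s, ~~ adj s w & ~~ adj x w]} ->
    (forall y, adj x y -> y \in inner -> ~~ adj s y -> exists2 w, w \in W & adj w y) ->
  False.
Proof.
move=> sS xR sx /indepP iW hW dom.
have /innerP[xL xS] := xR.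
pose Q := (nbh x :&: supports) :\ s.
have QS q : q \in Q -> q \in supports by rewrite !inE => /and3P[_ _].
have Qx q : q \in Q -> adj x q by rewrite !inE => /and3P[_].
have adj_lf q v : q \in supports -> adj (leaf_of q) v -> v = q.
  by move=> qS; rewrite -in_nbh (nbh_leaf_of qS) => /set1P.
have adj_lf' q v : q \in supports -> adj v (leaf_of q) -> v = q.
  by move=> qS; rewrite adj_sym; apply: adj_lf.
have iA : independent (s |: (W :|: leaf_of @: Q)).
  rewrite indepU1; last first.
    rewrite inE negb_or; apply/andP; split.
      by apply/negP => /hW[]; rewrite eqxx.
    apply/imsetP => -[q /QS/leaf_ofP[lL _] e].
    by have := leaf_not_support lL; rewrite -e sS.
  apply/andP; split.
    apply/indepP => a b /setUP[aW|/imsetP[q qQ ->]] /setUP[bW|/imsetP[q' q'Q ->]].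
    - exact: iW.
    - apply/negP => /(adj_lf' _ _ (QS _ q'Q)) e; have [_ _] := hW a aW.
      by rewrite e Qx.
    - apply/negP => /(adj_lf _ _ (QS _ qQ)) e; have [_ _] := hW b bW.
      by rewrite e Qx.
    - apply/negP => /(adj_lf _ _ (QS _ qQ)) e.
      have [lL _] := leaf_ofP (QS _ q'Q); have := leaf_not_support lL.
      by rewrite e QS.
  apply/pred0P => y /=; apply/negP => /andP[/setUP[yW|/imsetP[q qQ ->]]].
    by rewrite inE; apply/negP; have [] := hW y yW.
  by rewrite inE => /(adj_lf' _ _ (QS _ qQ)) e; move: qQ; rewrite -e !inE eqxx.
have [B mB sAB] := extend_indep iA.
have /indepP iB := maxsetp mB.
have sB : s \in B by apply: (subsetP sAB); rewrite setU11.
have [lL sl] := leaf_ofP sS.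
apply: (wc_exchange mB sB (a := x) (c := leaf_of s)).
- by apply/negP => xB; have := iB s x sB xB; rewrite sx.
- by apply/negP => lB; have := iB s _ sB lB; rewrite sl.
- by apply: contraNneq xL => ->.
- by apply/negP => /(adj_lf' _ _ sS) e; rewrite e sS in xS.
- move=> y yB xy; apply/eqP; apply: contraT => ys.
  have sy : ~~ adj s y by apply: iB.
  have := nbr_inner xR xy; rewrite not_leafP => /orP[yS|yR].
    have yQ : y \in Q by rewrite !inE ys xy; move: yS; rewrite inE.
    have lB : leaf_of y \in B by apply: (subsetP sAB); rewrite !inE imset_f ?orbT.
    by have [_ yl] := leaf_ofP yS; have := iB y _ yB lB; rewrite yl.
  have [w wW wy] := dom y xy yR sy.
  have wB : w \in B by apply: (subsetP sAB); rewrite !inE wW !orbT.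
  by have := iB w y wB yB; rewrite wy.
- by move=> y _ /(adj_lf _ _ sS).
Qed.

(** Each inner neighbour [y] of [x] not adjacent to [s] is dominated by a neighbour [w y] other than
    [x]. As [no_dominating] excludes these vertices as [W], some adjacency spoils them: [w y] with
    [s] closes a 4-cycle, with [x] a triangle, with another [w y'] a 5-cycle. *)
Lemma short_cycle s x : s \in supports -> x \in inner -> adj s x ->
  exists c : seq G, [/\ gcycle c, x \in c & (size c <= 5)%N].
Proof.
move=> sS xR sx.
pose Y := [set y | [&& adj x y, y \in inner & ~~ adj s y]].
pose w y := odflt y [pick v | adj y v && (v != x)].
have wP y : y \in Y -> adj y (w y) /\ w y != x.
  rewrite inE /w => /and3P[xy /innerP[yL _] _].
  have [v] : exists v, v \in nbh y :\ x.
    apply/set0Pn; rewrite -card_gt0; have := cardsD1 x (nbh y).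
    by have := nbh_gt1 yL; case: (x \in _); lia.
  rewrite !inE => /andP[vx yv].
  by case: pickP => [v' /andP[]|/(_ v)] //; rewrite yv vx.
have [/exists_inP[y yY sw]|/exists_inPn n1] := boolP [exists y in Y, adj s (w y)].
  have [yw wx] := wP y yY; move: yY; rewrite inE => /and3P[xy /innerP[_ yS] sy].
  exists [:: s; x; y; w y]; rewrite !inE eqxx orbT; split => //.
  apply: gcycle4; rewrite // 1?adj_sym // 1?eq_sym //.
  by apply: contraNneq yS => ->.
have [/exists_inP[y yY xw]|/exists_inPn n2] := boolP [exists y in Y, adj x (w y)].
  have [yw wx] := wP y yY; move: yY; rewrite inE => /and3P[xy _ sy].
  exists [:: x; y; w y]; rewrite !inE eqxx; split => //.
  by apply: gcycle3; rewrite // adj_sym.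
have [/exists_inP[y yY /exists_inP[y' y'Y ww]]|n3] :=
    boolP [exists y in Y, exists y' in Y, adj (w y) (w y')].
  have [yw wx] := wP y yY; have [y'w w'x] := wP y' y'Y.
  have n2y := n2 y yY; have n2y' := n2 y' y'Y.
  move: yY y'Y; rewrite !inE => /and3P[xy _ sy] /and3P[xy' _ sy'].
  exists [:: x; y; w y; w y'; y']; rewrite !inE eqxx; split => //.
  apply: gcycle5; rewrite // 1?adj_sym // 1?eq_sym //.
  - by apply: contraNneq n2y' => ->.
  - by apply: contraTneq ww => ->; rewrite adj_irrefl.
  - by apply: contraNneq n2y => <-.
exfalso; apply: (@no_dominating s x (w @: Y)) => //.
- apply/indepP => a b /imsetP[y yY ->] /imsetP[y' y'Y ->].
  by move/exists_inPn: n3 => /(_ y yY)/exists_inPn/(_ y' y'Y).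
- move=> v /imsetP[y yY ->]; split; [|exact: n1|exact: n2].
  have [yw _] := wP y yY; move: yY; rewrite inE => /and3P[_ _ sy].
  by apply: contraNneq sy => <-; rewrite adj_sym.
- move=> y xy yR sy; have yY : y \in Y by rewrite inE xy yR.
  by exists (w y); [apply: imset_f | rewrite adj_sym; have [] := wP y yY].
Qed.

Hypothesis uniG : unicyclic G.
Hypothesis evenG : ~~ odd #|G|.
Hypothesis G_gt5 : (5 < #|G|)%N.

Lemma deg2_nbh v (a b : G) : #|nbh v| = 2%N -> a != b -> adj v a -> adj v b ->
  nbh v = [set a; b].
Proof.
move=> dv ab va vb; apply/esym/eqP; rewrite eqEcard subUset !sub1set !inE va vb.
by rewrite dv cards2 ab.
Qed.

Lemma gcycle_neq0 (c : seq G) : gcycle c -> [set x in c] != set0.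
Proof.
case: c => [|x p] // _; apply/set0Pn; exists x; rewrite inE; exact: mem_head.
Qed.

(** Without leaves [G] is a cycle with at least six vertices. There [v3] can be exchanged for [v2]
    and [v4], since [v0] and [u] exclude their other neighbours [v1] and [v5]. *)
Lemma leaves_neq0 : leaves != set0.
Proof.
apply/negP => /eqP L0.
have notL v : v \notin leaves by rewrite L0 inE.
have [c gc] := unicyclic_gcycle uniG.
have eG := unicyclic_dedges connG uniG.
pose Z := [set x in c].
have X0 : ~: Z = set0.
  apply: (no_outside connG (eq_leq eG) (gcycle_neq0 gc) (dedges_gcycle gc)).
    by rewrite disjoint_sym disjoints_subset setCK.
  move=> x _; split; first exact: nbh_gt1.
  by rewrite -/Z setUC setUCr subsetT.
have memc x : x \in c by have := in_set0 x; rewrite -X0 !inE => /negbFE.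
(* The degrees are at least 2 and sum to [2 * #|G|]. *)
have deg2 v : #|nbh v| = 2%N.
  have e : (\sum_(x in [set: G]) (#|nbh x| - 2) = 0)%N.
    rewrite sumnB => [|x _]; last exact: nbh_gt1.
    rewrite sum_nat_const cardsT mulnC -eG /dedges.
    by under eq_bigr do rewrite -[nbh _]setIT; rewrite subnn.
  move/eqP: e; rewrite sum_nat_eq0 => /forall_inP/(_ v); rewrite inE => /(_ isT).
  by have := nbh_gt1 (notL v); lia.
have sizec : size c = #|G|.
  have /gcycleP[_ /andP[_ uc]] := gc.
  by rewrite -(card_uniqP uc); apply: eq_card => x; rewrite memc.
have /gcycleP[_ /andP[]] := gc.
case: c sizec {gc Z X0 memc} => [|v0 [|v1 [|v2 [|v3 [|v4 [|v5 r]]]]]] sizec;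
  try by move: G_gt5; rewrite -sizec.
move=> /= /and5P[a01 a12 a23 a34 /andP[a45 pr]].
rewrite !inE !negb_or.
move=> /and5P[/and5P[n01 n02 n03 n04 /andP[n05 nr0]] /and5P[n12 n13 n14 n15 nr1]].
move=> /and4P[n23 n24 n25 nr2] /and3P[n34 n35 nr3] /and3P[/andP[n45 nr4] nr5 ur].
(* The successor of [v5] on the cycle; for a hexagon it is the default [v0]. *)
pose u := head v0 r.
have a5u : adj v5 u by move: pr; rewrite /u; case: (r) => [|v6 r'] /= /andP[].
have n3 : nbh v3 = [set v2; v4] by apply: deg2_nbh; rewrite // adj_sym.
have n2 : nbh v2 = [set v1; v3] by apply: deg2_nbh; rewrite // adj_sym.
have n4 : nbh v4 = [set v3; v5] by apply: deg2_nbh; rewrite // adj_sym.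
have ur' (v : G) : v != v0 -> v \notin r -> v != u.
  rewrite /u; case: (r) => [|v6 r'] //= _; rewrite inE negb_or => /andP[].
  by [].
(* This is where parity enters: on seven vertices [u] would be adjacent to [v0]. *)
have a0u : ~~ adj v0 u.
  move: pr nr1 ur sizec; rewrite /u.
  case: (r) => [|v6 r'] /=; first by rewrite adj_irrefl.
  rewrite inE negb_or => /andP[_ pr'] /andP[n16 n1r] /andP[n6r _] sizec.
  have [z [zr z0]] : exists z, z \in r' /\ adj z v0.
    case: r' pr' sizec {n6r n1r} => [|z r'] /=.
      by move=> _ e; move: evenG; rewrite -e.
    rewrite rcons_path => /and3P[_ _ lz] _; exists (last z r'); split => //.
    exact: mem_last.
  have n1z : v1 != z by apply: contraNneq n1r => ->.
  have n0 : nbh v0 = [set v1; z] by apply: deg2_nbh; rewrite // adj_sym.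
  rewrite -in_nbh n0 !inE negb_or eq_sym n16 /=.
  by apply: contraNneq n6r => ->.
have iA : independent [set v3; v0; u].
  have h3 v : v != v2 -> v != v4 -> ~~ adj v3 v.
    by rewrite -in_nbh n3 !inE negb_or => -> ->.
  have h30 : ~~ adj v3 v0 by apply: h3.
  have h3u : ~~ adj v3 u by apply: h3; rewrite eq_sym; apply: ur'; rewrite // eq_sym.
  apply/indepP => x y; rewrite !inE.
  by do 2![case/orP=> [/orP[]|] /eqP->]; rewrite ?adj_irrefl // adj_sym.
have [B mB sAB] := extend_indep iA.
have /indepP iB := maxsetp mB.
have inB v : v \in [set v3; v0; u] -> v \in B by apply: (subsetP sAB).
have v3B : v3 \in B by apply: inB; rewrite !inE eqxx.
have v0B : v0 \in B by apply: inB; rewrite !inE eqxx orbT.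
have uB : u \in B by apply: inB; rewrite !inE eqxx !orbT.
have notB v w : w \in B -> adj w v -> v \notin B.
  by move=> wB wv; apply/negP => vB; have := iB w v wB vB; rewrite wv.
apply: (wc_exchange mB v3B (a := v2) (c := v4)) => //.
- by apply: (notB _ v3); rewrite // adj_sym.
- exact: (notB _ v3).
- by rewrite -in_nbh n2 !inE negb_or eq_sym n14 eq_sym n34.
- move=> y yB; rewrite -in_nbh n2 => /set2P[] // e.
  by have := notB _ _ v0B a01; rewrite -e yB.
- move=> y yB; rewrite -in_nbh n4 => /set2P[] // e.
  by have := notB _ _ uB (_ : adj u v5); rewrite -e yB adj_sym e => /(_ a5u).
Qed.

(** A further neighbour of [x] would be a support; with it in the role of [s], the set {z} dominates
    [y], the only inner neighbour of [x]. *)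
Lemma square_nbh s x y z : gcycle [:: s; x; y; z] -> s \in supports ->
    z \in supports -> inner = [set x; y] ->
  nbh x = [set s; y].
Proof.
move=> gc sS zS eR.
have xR : x \in inner by rewrite eR set21.
have yR : y \in inner by rewrite eR set22.
have /gcycleP[_ /andP[/= /and5P[sx xy yz zs _]]] := gc.
rewrite !inE !negb_or => /and4P[/and3P[nsx nsy nsz] /andP[nxy nxz] nyz _].
have adjxz : ~~ adj x z.
  apply/negP => xz; have g3 : gcycle [:: x; y; z] by apply: gcycle3; rewrite // adj_sym.
  have := unicyclic_vertices uniG gc g3 s.
  by rewrite !inE eqxx /= (negbTE nsx) (negbTE nsy) (negbTE nsz).
apply/eqP; rewrite eqEsubset andbC subUset !sub1set !in_nbh adj_sym sx xy /=.
apply/subsetP => v; rewrite in_nbh => xv; apply: contraT.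
rewrite !inE negb_or => /andP[vs vy].
have vS : v \in supports.
  have := nbr_inner xR xv; rewrite not_leafP => /orP[//|].
  by rewrite eR => /set2P[e|e]; [rewrite e adj_irrefl in xv | rewrite e eqxx in vy].
have nzv : z != v by apply: contraNneq adjxz => ->.
exfalso; apply: (@no_dominating v x [set z]) => //; first by rewrite adj_sym.
- by apply/indepP => a b /set1P-> /set1P->; rewrite adj_irrefl.
- move=> w /set1P->; split => //; apply/negP => vz.
  have g4 : gcycle [:: v; x; y; z].
    by apply: gcycle4; rewrite // 1?adj_sym //.
  have := unicyclic_vertices uniG gc g4 v; rewrite !inE eqxx /=.
  rewrite (negbTE vs) (negbTE vy) [v == z]eq_sym (negbTE nzv) /= orbF.
  by move/eqP => e; rewrite e adj_irrefl in xv.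
- move=> y0 xy0; rewrite eR => /set2P[e|-> _]; first by rewrite e adj_irrefl in xy0.
  by exists z; rewrite ?set11 // adj_sym.
Qed.

Lemma inner_cases : inner = set0 \/ exists s x y z,
  [/\ gcycle [:: s; x; y; z], s \in supports, z \in supports & inner = [set x; y]].
Proof.
have [->|R0] := eqVneq inner set0; [by left | right].
have eG := unicyclic_dedges connG uniG.
have RT : inner != setT.
  apply: contraNneq leaves_neq0 => RT; rewrite -subset0; apply/subsetP => v vL.
  by have := in_setT v; rewrite -RT => /innerP[]; rewrite vL.
have [x1 [s1 [x1R _ s1R xs1]]] := conn_adj_out connG (subsetT _) R0 RT.
have s1S : s1 \in supports.
  by have := nbr_inner x1R xs1; rewrite not_leafP (negbTE s1R) orbF.
have sx1 : adj s1 x1 by rewrite adj_sym.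
have [c [gc x1c sizec]] := short_cycle s1S x1R sx1.
have eqc := unicyclic_vertices uniG gc.
(* An inner vertex off [c] has no support as neighbour, since [short_cycle] would put it on the
   unique cycle. So [no_outside] applies to these vertices. *)
have sRc x : x \in inner -> x \in c.
  suff X0 : inner :\: [set x in c] = set0.
    move=> xR; have := in_set0 x; rewrite -X0 in_setD xR andbT inE.
    by move/negbFE.
  apply: (no_outside connG (eq_leq eG) (gcycle_neq0 gc) (dedges_gcycle gc)).
    rewrite disjoints_subset; apply/subsetP => v.
    by rewrite in_setD in_setC => /andP[].
  move=> v /setDP[vR vc]; split; first by apply: nbh_gt1; have /innerP[] := vR.
  apply/subsetP => w; rewrite in_nbh => vw.
  have := nbr_inner vR vw; rewrite not_leafP => /orP[wS|wR]; last first.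
    by rewrite in_setU in_setD wR andbT; case: (w \in _).
  have [|c' [gc' vc' _]] := short_cycle wS vR; first by rewrite adj_sym.
  by move: vc; rewrite inE (eqc _ gc') vc'.
have oddR : ~~ odd #|inner|.
  by move: evenG; rewrite card_inner oddD oddM.
have gc2 := gc; case/gcycleP: gc2 => sc /andP[_ uc].
(* If all of [c] is inner, parity makes it a 4-cycle, and the vertex opposite to [x1] dominates both
   inner neighbours of [x1]. *)
have [allR|nallR] := boolP (all (mem inner) c).
  have cR : #|inner| = size c.
    rewrite -(card_uniqP uc); apply: eq_card => v; apply/idP/idP; first exact: sRc.
    exact: (allP allR).
  have {cR oddR} size4 : size c = 4%N by move: oddR; rewrite cR; lia.
  exfalso; have [i p e] := rot_to x1c.
  have gp : gcycle (x1 :: p) by rewrite -e gcycle_rot.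
  have ec : c =i x1 :: p by move=> v; rewrite -e mem_rot.
  have : size (x1 :: p) = 4%N by rewrite -e size_rot.
  case: p {e} gp ec => [|y [|w [|y' []]]] // gp ec _.
  have /gcycleP[_ /andP[/= /and5P[xy yw wy' y'x _]]] := gp.
  rewrite !inE !negb_or => /and4P[/and3P[nxy nxw nxy'] /andP[nyw nyy'] nwy' _].
  have s1c : s1 \notin c by apply: contra s1R; apply: (allP allR).
  have wR : w \in inner by apply: (allP allR); rewrite ec !inE eqxx !orbT.
  have adjxw : ~~ adj x1 w.
    apply/negP => xw.
    have g3 : gcycle [:: x1; y; w] by apply: gcycle3; rewrite // adj_sym.
    have := eqc _ g3 y'; rewrite ec !inE eqxx !orbT.
    by rewrite eq_sym (negbTE nxy') eq_sym (negbTE nyy') eq_sym (negbTE nwy').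
  apply: (@no_dominating s1 x1 [set w]) => //.
  - by apply/indepP => a b /set1P-> /set1P->; rewrite adj_irrefl.
  - move=> v /set1P->; split => //; first by apply: contraNneq s1R => <-.
    apply/negP => sw; have g4 : gcycle [:: s1; x1; y; w].
      apply: gcycle4; rewrite // 1?adj_sym //.
      by apply: contraNneq s1c => ->; rewrite ec !inE eqxx orbT.
    by move: s1c; rewrite (eqc _ g4) mem_head.
  - move=> y0 xy0 y0R _; exists w; rewrite ?set11 //.
    have := sRc y0 y0R; rewrite ec !inE => /or4P[]/eqP e.
    + by rewrite e adj_irrefl in xy0.
    + by rewrite e adj_sym.
    + by rewrite e (negbTE adjxw) in xy0.
    + by rewrite e.
have hasR : has (mem inner) c by apply/hasP; exists x1.
have [s [x [q [gq sq ec sR xR]]]] := gcycle_boundary gc hasR nallR.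
have {}sR : s \notin inner by [].
have {}xR : x \in inner by [].
have sS : s \in supports.
  have [|a [b [nab _ _ sa sb]]] := gcycle_nbrs gq (x := s); first exact: mem_head.
  have : s \notin leaves.
    apply/negP => sL; have ea := leaf_nbh sL sa.
    by case/eqP: nab; apply/esym/set1P; rewrite -ea in_nbh.
  by rewrite not_leafP (negbTE sR) orbF.
have in_q v : v \in inner -> v \in s :: x :: q by move/sRc; rewrite ec.
have neqs v : v \in inner -> (v == s) = false.
  by move=> vR; apply/negbTE; apply: contraNneq sR => <-.
have /gcycleP[_ /andP[/andP[sx _] _]] := gq.
have i0 : independent (set0 : {set G}) := indep0 G.
have i1 v : independent [set v : G].
  by apply/indepP => a b /set1P-> /set1P->; rewrite adj_irrefl.
have gcq := unicyclic_vertices uniG gq.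
case: q sq ec gq in_q gcq => [|y [|z [|w [|? ?]]]] sq ec gq in_q gcq.
- by move: sc; rewrite sq.
(* Triangle: [y] is adjacent to [s], so the empty set suffices. *)
- exfalso; have /gcycleP[_ /andP[/= /and4P[_ xy ys _] _]] := gq.
  apply: (no_dominating sS xR sx i0) => [v|y0 xy0 y0R]; first by rewrite inE.
  have := in_q y0 y0R; rewrite !inE neqs //= => /orP[]/eqP e.
    by rewrite e adj_irrefl in xy0.
  by rewrite e adj_sym ys.
- have /gcycleP[_ /andP[/= /and5P[_ xy yz zs _]]] := gq.
  rewrite !inE !negb_or => /and4P[/and3P[nsx nsy nsz] /andP[nxy nxz] nyz _].
  have yR : y \in inner.
    (* Otherwise [z] alone could be an inner neighbour of [x], and it is adjacent to [s]. Next,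
       parity keeps [z] out of [inner]. *)
    apply: contraT => yR; exfalso.
    apply: (no_dominating sS xR sx i0) => [v|y0 xy0 y0R]; first by rewrite inE.
    have := in_q y0 y0R; rewrite !inE neqs //= => /or3P[]/eqP e.
    + by rewrite e adj_irrefl in xy0.
    + by case/negP: yR; rewrite -e.
    + by rewrite e adj_sym zs.
  have zR : z \notin inner.
    apply/negP => zR; move: oddR.
    have -> : #|inner| = size [:: x; y; z].
      rewrite -(card_uniqP (_ : uniq [:: x; y; z])); last by rewrite /= !inE negb_or nxy nxz nyz.
      apply: eq_card => v; apply/idP/idP => [vR|].
        by have := in_q v vR; rewrite inE neqs.
      by rewrite 3!in_cons in_nil orbF => /or3P[]/eqP->.
    by [].
  have eR : inner = [set x; y].
    apply/setP => v; rewrite in_set2; apply/idP/orP => [vR|[]/eqP-> //].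
    have := in_q v vR; rewrite !inE neqs //= => /or3P[->|->|/eqP e]; [by left | by right | ].
    by case/negP: zR; rewrite -e.
  exists s, x, y, z; split => //.
  have := nbr_inner yR yz; by rewrite not_leafP (negbTE zR) orbF.
(* 5-cycle: [z] dominates [y], the vertex [w] is adjacent to [s], and chords are excluded by
   uniqueness of the cycle. *)
- exfalso.
  have /gcycleP[_ /andP[/= /and5P[_ xy yz zw /andP[ws _]]]] := gq.
  rewrite !inE !negb_or => /and5P[/and4P[nsx nsy nsz nsw] /and3P[nxy nxz nxw]].
  move=> /andP[nyz nyw] nzw _.
  have adjxz : ~~ adj x z.
    apply/negP => xz.
    have g3 : gcycle [:: x; y; z] by apply: gcycle3; rewrite // adj_sym.
    have := gcq _ g3 s.
    by rewrite !inE eqxx /= (negbTE nsx) (negbTE nsy) (negbTE nsz).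
  apply: (no_dominating sS xR sx (i1 z)) => [v /set1P->|y0 xy0 y0R nsy0].
    split => //; first by rewrite eq_sym.
    apply/negP => sz.
    have g3 : gcycle [:: s; z; w] by apply: gcycle3.
    have := gcq _ g3 x.
    by rewrite !inE eqxx orbT [x == s]eq_sym (negbTE nsx) (negbTE nxz) (negbTE nxw).
  exists z; rewrite ?set11 //.
  have := in_q y0 y0R; rewrite !inE neqs //= => /or4P[]/eqP e.
  + by rewrite e adj_irrefl in xy0.
  + by rewrite e adj_sym.
  + by rewrite e (negbTE adjxz) in xy0.
  + by rewrite e adj_sym ws in nsy0.
- by move: sizec; rewrite sq.
Qed.

End WellCovered.

Lemma ipoly_eq_adj (G : sgraph) (e : rel G) (se : symmetric e)
    (ie : irreflexive e) (R : comPzRingType) (x : R) (S : {set G}) :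
    {in S &, e =2 @adj G} ->
  @ipoly (SGraph se ie) R S x = ipoly S x.
Proof.
move=> eS; apply: eq_bigl => A; have [sAS|//] := boolP (A \subset S).
apply/indepP/indepP => iA a b aA bA; have := iA a b aA bA => /=;
  by rewrite eS //; apply: (subsetP sAS).
Qed.

(** * Turning the exceptional 4-cycle into a triangle *)

Section SwitchEdge.

Variables (G : sgraph) (s x y z : G).
Hypothesis nbhx : nbh x = [set s; y].
Hypothesis nbhy : nbh y = [set z; x].
Hypothesis zs : adj z s.

(* The 4-cycle s, x, y, z is replaced by the triangle s, x, z, and y becomes a
   leaf attached to x. *)
Definition switch_adj : rel G := fun u v =>
  adj u v && ~~ is_pair y z u v || is_pair x z u v.

Let xy : adj x y. Proof. by rewrite -in_nbh nbhx set22. Qed.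
Let yz : adj y z. Proof. by rewrite -in_nbh nbhy set21. Qed.
Let nxy : x != y. Proof. exact: adj_neq. Qed.
Let nyz : y != z. Proof. exact: adj_neq. Qed.
Let nzs : z != s. Proof. exact: adj_neq. Qed.

Let nxz : ~~ adj x z.
Proof. by rewrite -in_nbh nbhx !inE negb_or nzs eq_sym nyz. Qed.

Hypothesis x_neq_z : x != z.

Fact switch_adj_sym : symmetric switch_adj.
Proof. by move=> u v; rewrite /switch_adj adj_sym is_pair_sym (is_pair_sym x). Qed.

Fact switch_adj_irrefl : irreflexive switch_adj.
Proof.
move=> u; rewrite /switch_adj adj_irrefl /is_pair /= [_ && (u == x)]andbC orbb.
by apply/negP => /andP[/eqP-> /eqP e]; move: x_neq_z; rewrite e eqxx.
Qed.

Definition switch : sgraph := SGraph switch_adj_sym switch_adj_irrefl.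

Let switchE (u v : G) : @adj switch u v = @adj G u v && ~~ is_pair y z u v || is_pair x z u v.
Proof. by []. Qed.

Lemma switch_nbhy : @nbh switch y = [set x].
Proof.
apply/setP => v; rewrite in_nbh switchE -in_nbh nbhy !inE /is_pair eqxx.
rewrite (negbTE nyz) [y == x]eq_sym (negbTE nxy) /= orbF andbC.
by case: eqP => [->|//]; rewrite eq_sym (negbTE x_neq_z).
Qed.

Lemma switch_nbhx : @nbh switch x = z |: nbh x.
Proof.
apply/setP => v; rewrite in_nbh switchE !inE /is_pair eqxx.
by rewrite (negbTE nxy) (negbTE x_neq_z) /= orbF andbT orbC.
Qed.

Lemma switch_nbhz : @nbh switch z = x |: (nbh z :\ y).
Proof.
apply/setP => v; rewrite in_nbh switchE !inE /is_pair eqxx [z == y]eq_sym.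
by rewrite (negbTE nyz) [z == x]eq_sym (negbTE x_neq_z) /= orbC andbC.
Qed.

Lemma switch_adj_other (u v : G) : u != x -> u != y -> u != z -> @adj switch u v = @adj G u v.
Proof.
move=> ux uy uz; rewrite switchE /is_pair.
by rewrite (negbTE ux) (negbTE uy) (negbTE uz) /= andbT orbF.
Qed.

Lemma switch_nbh_other (v : G) : v != x -> v != y -> v != z ->
  @nbh switch v = @nbh G v.
Proof.
move=> vx vy vz; apply/setP => u; apply: etrans (@in_nbh switch v u) _.
by apply: etrans (esym (@in_nbh G v u)); apply: switch_adj_other.
Qed.

Lemma switch_conn : conn [set: G] -> conn [set: switch].
Proof.
move=> [nT cT]; split=> // C sC C0 clC; apply: (cT C) => // u v uC _ uv.
have xyC : (x \in C) = (y \in C).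
  apply/idP/idP => h; apply: (clC _ _ h) => //.
    by rewrite -in_nbh switch_nbhx !inE xy orbT.
  by rewrite -in_nbh switch_nbhy inE.
have xzC : (x \in C) = (z \in C).
  apply/idP/idP => h; apply: (clC _ _ h) => //.
    by rewrite -in_nbh switch_nbhx setU11.
  by rewrite -in_nbh switch_nbhz setU11.
have [/orP[]/andP[/eqP eu /eqP ev]|h] := boolP (is_pair y z u v).
- by rewrite ev -xzC xyC -eu.
- by rewrite ev -xyC xzC -eu.
by apply: (clC u) => //; rewrite switchE uv h.
Qed.

(** The degree of [x] rises from 2 to 3, that of [y] falls from 2 to 1, and [z] exchanges one
    neighbour for another. *)
Lemma switch_dedges : dedges [set: switch] = dedges [set: G].
Proof.
rewrite /dedges; have nT (H : sgraph) (v : H) : #|nbh v :&: setT| = #|nbh v| by rewrite setIT.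
rewrite (eq_bigr _ (fun v _ => nT G v)) (eq_bigr _ (fun v _ => nT switch v)).
rewrite (bigD1 x) ?inE //= (bigD1 y) ?inE //= 1?eq_sym //.
rewrite [in RHS](bigD1 x) ?inE //= [in RHS](bigD1 y) ?inE //= 1?eq_sym //.
rewrite switch_nbhx switch_nbhy cardsU1 in_nbh nxz nbhy cards1 cards2.
rewrite eq_sym x_neq_z /=.
set X := (\sum_(i | _) _)%N; set Y := (X in _ = (_ + (_ + X))%N).
suff -> : X = Y by lia.
apply: eq_big => [v|v /andP[/andP[_ vx] vy]]; first by rewrite !inE.
have [->|vz] := eqVneq v z.
  rewrite switch_nbhz cardsU1 !inE (adj_sym z x) (negbTE nxz) andbF add1n.
  by rewrite [RHS](cardsD1 y) inE (adj_sym z y) yz.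
by rewrite switch_nbh_other.
Qed.

(* Remove z: the independent sets containing z may contain x but not y in G,
   and y but not x in the switched graph; both vertices are then isolated. *)
Lemma switch_ipoly (R : comPzRingType) (t : R) :
  ipoly [set: switch] t = ipoly [set: G] t.
Proof.
have same (S : {set G}) : z \notin S -> @ipoly switch R S t = ipoly S t.
  move=> zS; apply: ipoly_eq_adj => u v uS vS.
  have uz : u != z by apply: contraNneq zS => <-.
  have vz : v != z by apply: contraNneq zS => <-.
  by rewrite /switch_adj /is_pair (negbTE uz) (negbTE vz) !andbF /= andbT orbF.
pose Q : {set G} := (((setT :\ z) :\: nbh z) :\ x).
have zQ : z \notin Q by rewrite !inE eqxx !andbF.
have xU : x \in (setT :\ z) :\: nbh z.
  by rewrite !inE (adj_sym z x) nxz x_neq_z.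
have yU : y \in ([set: switch] :\ z) :\: @nbh switch z.
  by rewrite switch_nbhz !inE eqxx /= orbF [y == x]eq_sym nxy nyz.
have eQ : (([set: switch] :\ z) :\: @nbh switch z) :\ y = Q.
  rewrite switch_nbhz; apply/setP => v; rewrite !inE.
  have [->|vy] := eqVneq v y; first by rewrite (adj_sym z y) yz andbF.
  by rewrite negb_or /= -andbA.
rewrite (@ipoly_rec switch _ _ setT z) ?inE // (@ipoly_rec G _ _ setT z) ?inE //.
congr (_ + _ * _); first by apply: same; rewrite !inE eqxx.
have dy : [disjoint ([set: switch] :\ z) :\: @nbh switch z & @nbh switch y].
  rewrite switch_nbhy disjoint_sym disjoints1 switch_nbhz.
  by rewrite !inE eqxx.
have dx : [disjoint (setT :\ z) :\: nbh z & nbh x].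
  rewrite nbhx disjoints_subset; apply/subsetP => v; rewrite !inE negb_or.
  move=> /andP[zv _]; apply/andP; split; apply: contraNneq zv => ->; first exact: zs.
  by rewrite adj_sym.
apply: etrans (@ipoly_isolated switch R t _ y yU dy) _.
apply: etrans (esym (@ipoly_isolated G R t _ x xU dx)).
by rewrite eQ -/Q same.
Qed.

Lemma switch_xi : xi switch = xi G.
Proof.
have e : indep_poly switch = indep_poly G.
  by rewrite !indep_polyE switch_ipoly.
by rewrite /xi /indep_roots e.
Qed.

End SwitchEdge.

(** * Reduction of well-covered graphs to graph stars *)

Lemma connected_conn (G : sgraph) : connected_graph G -> conn [set: G].
Proof.
move=> [/card_gt0P[v _] cG]; split; first by apply/set0Pn; exists v.
move=> C _ /set0Pn[x xC] clC; apply/setP => y; rewrite in_setT.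
have clo : closed (@adj G) (mem C).
  move=> a b ab; apply/idP/idP => h; first exact: (clC a).
  by apply: (clC b) => //; rewrite adj_sym.
by have := closed_connect clo (cG x y); rewrite /= xC => <-.
Qed.

Theorem corollary3p13 (n : nat) (hn : (3 <= n)%N) (G : sgraph)
  (hconn : connected_graph G) (huni : unicyclic G) (hwc : well_covered G)
  (hord : #|G| = (2 * n)%N) :
  xi (graph_star (Cn n)) <= xi G <= xi (graph_star (Un n)).
Proof.
have cG := connected_conn hconn.
have eG := unicyclic_dedges cG huni.
have gt2 : (2 < #|G|)%N by lia.
have gt5 : (5 < #|G|)%N by lia.
have ev : ~~ odd #|G| by rewrite hord oddM.
have lf := leaf_ofP (G := G).
have lfN := nbh_leaf_of (G := G).
have lfI := leaf_of_img hwc cG gt2.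
have cardI := card_inner hwc cG gt2.
have notS := leaf_not_support cG gt2.
have [R0|[s [x [y [z [gc sS zS eR]]]]]] := inner_cases hwc cG gt2 huni ev gt5.
  (* Without inner vertices [G] is itself a graph star over its supports. *)
  apply: (starred_bounds hn (pi := @leaf_of G) (P := supports G)) => //; last first.
    by move: cardI; rewrite R0 cards0 hord; lia.
  split=> [p pS|]; first by split; [apply/notS; have [] := lf p pS | exact: lfN].
  apply/setP => v; rewrite inE lfI orbC -in_setU in_setT.
  by apply: negbFE; rewrite -in_setC -/(inner G) R0 inE.
have /gcycleP[_ /andP[/= /and5P[sx xy yz zs _]]] := gc.
rewrite !inE !negb_or => /and4P[/and3P[nsx nsy nsz] /andP[nxy nxz] nyz _].
have nbhx := square_nbh hwc cG gt2 huni gc sS zS eR.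
(* The cycle read backwards exchanges the roles of [x] and [y]. *)
have gc' : gcycle [:: z; y; x; s].
  by apply: gcycle4; rewrite // 1?adj_sym // 1?eq_sym.
have nbhy : nbh y = [set z; x].
  by apply: (square_nbh hwc cG gt2 huni gc' zS sS); rewrite eR setUC.
have xR : x \in inner G by rewrite eR set21.
have yR : y \in inner G by rewrite eR set22.
have [/innerP[xL xS] /innerP[yL yS]] := (xR, yR).
have zL : z \notin leaves G by apply: contraL zS => /notS.
rewrite -(switch_xi nbhx nbhy zs nxz).
pose G' := switch y nxz.
pose pi (v : G) := if v == x then y else leaf_of v.
have nxP p : p \in supports G -> p != x by move=> pS; apply: contraNneq xS => <-.
(* In the switched graph [x] joins the base and [y] is its leaf; the order is twice the number of
   supports plus 2. *)
have cardP : #|x |: supports G| = n.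
  by rewrite cardsU1 xS; move: cardI; rewrite eR cards2 nxy hord; clear; lia.
apply: (@starred_bounds n G' (x |: supports G) pi hn).
- split=> [p /setU1P[->|pS]|]; rewrite /pi.
  + rewrite eqxx; split; last exact: (switch_nbhy nbhx nbhy nxz).
    by rewrite in_setU1 negb_or yS andbT eq_sym.
  + rewrite (negbTE (nxP p pS)); have [lL pl] := lf p pS.
    have lx : @leaf_of G p != x by apply/eqP => e; case/negP: xL; rewrite -e; exact: lL.
    split.
      by apply/setU1P => -[/eqP|]; apply/negP; [exact: lx | exact: notS].
    apply: etrans (lfN p pS); apply: (switch_nbh_other nxz) => //.
      by apply/eqP => e; case/negP: yL; rewrite -e; exact: lL.
    by apply/eqP => e; case/negP: zL; rewrite -e; exact: lL.
  + have e : [set pi v | v in x |: supports G] = y |: leaves G.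
      rewrite imsetU1 /pi eqxx -lfI; congr (_ |: _).
      by apply: eq_in_imset => p pS; rewrite (negbTE (nxP p pS)).
    apply: etrans (congr1 (fun A => (x |: supports G) :|: A) e) _.
    rewrite setUACA -eR setUC -/(inner G) [supports G :|: _]setUC.
    by rewrite /inner setUCr.
- exact: (switch_conn nbhx nbhy nxz cG).
- exact: etrans (switch_dedges nbhx nbhy zs nxz) eG.
- exact: cardP.
Qed.
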